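(* Let $m\ge 1$ and let $G$ be a connected $m$-step nilpotent Lie group. Then $G$ has linear growth if and only if $m\le 2$.
   Context: $m$-step nilpotent means nilpotent of nilpotency class exactly $m$ (so $1$-step nilpotent means abelian); for connected $G$ this is equivalent to its Lie algebra being nilpotent of class exactly $m$. Let $G$ be a connected Lie group with unit $1$ and Lie algebra $\mathfrak{g}=T_1G$. For a left-invariant Riemannian metric $g_R$ on $G$, put $r(p)=d_R(1,p)$ for $p\in G$, where $d_R$ is the distance induced by $g_R$. The group $G$ is said to have (at most) linear growth if there exist a left-invariant Riemannian metric $g_R$ on $G$, a Euclidean scalar product on $\mathfrak{g}$ with norm $\Vert\cdot\Vert$, and real constants $a,b$ (with $a+b\,r(p)>0$) such that $$\frac{\Vert u\Vert}{a+b\,r(p)}\le \Vert \mathrm{Ad}_p(u)\Vert\le (a+b\,r(p))\,\Vert u\Vert$$ for every $p\in G$ and every $u\in\mathfrak{g}$. *)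

(* Defs.v *)
From HB Require Import structures.
From mathcomp Require Import all_boot all_order all_algebra.
From mathcomp Require Import all_classical all_reals all_analysis.

Set Implicit Arguments.
Unset Strict Implicit.
Unset Printing Implicit Defensive.

Import Order.TTheory GRing.Theory Num.Theory.
Import numFieldNormedType.Exports.

Local Open Scope classical_set_scope.
Local Open Scope ring_scope.

(* Meant for open A.  In finite dimension this is the usual C^k. *)
Fixpoint Ck_on (R : realType) (V W : normedModType R) (k : nat)
    (f : V -> W) (A : set V) : Prop :=
  match k with
  | 0%N => forall x, A x -> {for x, continuous f}
  | j.+1 => (forall x, A x -> differentiable f x) /\
            (forall v, Ck_on j (fun x => 'D_v f x) A)
  end.

Definition smooth_on (R : realType) (V W : normedModType R)
    (f : V -> W) (A : set V) : Prop := forall k, Ck_on k f A.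

(* A homeomorphism from the open set chart_dom onto the open set chart_cod;
   the values of the two maps outside these sets are irrelevant. *)
Record chart (R : realType) (n : nat) (M : topologicalType) := Chart {
  chart_fun :> M -> 'rV[R]_n;
  chart_inv : 'rV[R]_n -> M;
  chart_dom : set M;
  chart_cod : set 'rV[R]_n;
  chart_dom_open : open chart_dom;
  chart_cod_open : open chart_cod;
  chart_fun_cod : forall p, chart_dom p -> chart_cod (chart_fun p);
  chart_inv_dom : forall x, chart_cod x -> chart_dom (chart_inv x);
  chart_funK : forall p, chart_dom p -> chart_inv (chart_fun p) = p;
  chart_invK : forall x, chart_cod x -> chart_fun (chart_inv x) = x;
  chart_fun_continuous :
    forall p, chart_dom p -> {for p, continuous chart_fun};
  chart_inv_continuous :
    forall x, chart_cod x -> {for x, continuous chart_inv} }.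

(* The tangent space T_p M of an n-manifold is represented by 'rV[R]_n: a
   tangent vector is given by its coordinates in the preferred chart chart_at p.
   The smooth structure is the one generated by atlas, which need not be
   maximal. *)
HB.mixin Record isManifold (R : realType) (n : nat) M of Topological M := {
  atlas : set (chart R n M);
  chart_at : M -> chart R n M;
  manifold_hausdorff : hausdorff_space M;
  manifold_second_countable : @second_countable M;
  chart_at_atlas : forall p, atlas (chart_at p);
  chart_at_dom : forall p, chart_dom (chart_at p) p;
  atlas_compatible : forall f g, atlas f -> atlas g ->
    smooth_on (g \o chart_inv f)
      (chart_cod f `&` chart_inv f @^-1` chart_dom g) }.

#[short(type="manifoldType")]
HB.structure Definition Manifold (R : realType) (n : nat) :=
  { M of Topological M & isManifold R n M }.

Definition smooth_map (R : realType) (n k : nat)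
    (M : manifoldType R n) (N : manifoldType R k) (F : M -> N) : Prop :=
  continuous F /\
  forall (f : chart R n M) (g : chart R k N), atlas f -> atlas g ->
    smooth_on (g \o F \o chart_inv f)
      (chart_cod f `&` (F \o chart_inv f) @^-1` chart_dom g).

(* Smoothness of a map M1 x M2 -> N, read in the product charts. *)
Definition smooth_map2 (R : realType) (n1 n2 k : nat)
    (M1 : manifoldType R n1) (M2 : manifoldType R n2) (N : manifoldType R k)
    (F : M1 -> M2 -> N) : Prop :=
  continuous (fun z : M1 * M2 => F z.1 z.2) /\
  forall (f1 : chart R n1 M1) (f2 : chart R n2 M2) (g : chart R k N),
    atlas f1 -> atlas f2 -> atlas g ->
    let F' z := F (chart_inv f1 z.1) (chart_inv f2 z.2) in
    smooth_on (fun z : 'rV[R]_n1 * 'rV[R]_n2 => g (F' z))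
      ((chart_cod f1 `*` chart_cod f2) `&` F' @^-1` chart_dom g).

HB.mixin Record isLieGroup (R : realType) (n : nat) G
    of Manifold R n G & Group G := {
  mulg_smooth : smooth_map2 (fun p q : G => (p * q)%g);
  invg_smooth : smooth_map (fun p : G => p^-1%g) }.

#[short(type="lieGroupType")]
HB.structure Definition LieGroup (R : realType) (n : nat) :=
  { G of Manifold R n G & Group G & isLieGroup R n G }.

(* The differential T_p M -> T_(F p) N. *)
Definition mdiff (R : realType) (n k : nat)
    (M : manifoldType R n) (N : manifoldType R k) (F : M -> N) (p : M)
    (u : 'rV[R]_n) : 'rV[R]_k :=
  'D_u (chart_at (F p) \o F \o chart_inv (chart_at p)) (chart_at p p).

Definition scalar_product (R : realType) (n : nat) :=
  {dot 'rV[R]_n for (idfun : R -> R)}.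

Definition sp_norm (R : realType) (n : nat) (s : scalar_product R n)
  (u : 'rV[R]_n) : R := Num.sqrt (s u u).

(* The tangent vector at chart_inv f x whose coordinates in f are u. *)
Definition coord_vector (R : realType) (n : nat) (M : manifoldType R n)
    (f : chart R n M) (x u : 'rV[R]_n) : 'rV[R]_n :=
  'D_u (chart_at (chart_inv f x) \o chart_inv f) x.

Record riemannian_metric (R : realType) (n : nat) (M : manifoldType R n) :=
  RiemannianMetric {
  metric :> M -> scalar_product R n;
  metric_smooth : forall (f : chart R n M) (u v : 'rV[R]_n), atlas f ->
    smooth_on (fun x => metric (chart_inv f x)
                  (coord_vector f x u) (coord_vector f x v) : R^o)
      (chart_cod f) }.

Definition left_invariant (R : realType) (n : nat) (G : lieGroupType R n)
    (g : riemannian_metric G) : Prop :=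
  forall (p q : G) (u v : 'rV[R]_n),
    g (p * q)%g (mdiff (fun x : G => (p * x)%g) q u)
                (mdiff (fun x : G => (p * x)%g) q v) = g q u v.

Section Distance.
Variables (R : realType) (n : nat) (M : manifoldType R n).

(* Only the restriction to `[0, 1] matters: a curve that is C^1 on the closed
   interval is one with a C^1 extension to an open neighbourhood. *)
Definition C1_arc (c : R -> M) : Prop :=
  exists2 U : set R, open U /\ `[0, 1]%classic `<=` U &
    (forall t, U t -> {for t, continuous c}) /\
    forall f : chart R n M, atlas f ->
      @Ck_on R R^o 'rV[R]_n 1 (f \o c) (U `&` c @^-1` chart_dom f).

Definition velocity (c : R -> M) (t : R) : 'rV[R]_n :=
  derive1 (chart_at (c t) \o c) t.

Definition arc_length (g : riemannian_metric M) (c : R -> M) : R :=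
  (\int[lebesgue_measure]_(t in `[0, 1]) sp_norm (g (c t)) (velocity c t))%R.

(* A piecewise C^1 path is a sequence of C^1 arcs, each one starting where the
   previous one ends. *)
Fixpoint C1_path (p q : M) (s : seq (R -> M)) : Prop :=
  match s with
  | [::] => p = q
  | c :: s' => [/\ C1_arc c, c 0 = p & C1_path (c 1) q s']
  end.

Definition riemannian_dist (g : riemannian_metric M) (p q : M) : R :=
  inf [set \sum_(c <- s) arc_length g c | s in [set s | C1_path p q s]].

End Distance.

(* The differential at 1 of conjugation by p.  It takes values in the tangent
   space at p 1 p^-1 = 1. *)
Definition Ad (R : realType) (n : nat) (G : lieGroupType R n) (p : G) :
  'rV[R]_n -> 'rV[R]_n := mdiff (fun x : G => (p * x * p^-1)%g) 1%g.

Definition linear_growth (R : realType) (n : nat) (G : lieGroupType R n) :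
    Prop :=
  exists (g : riemannian_metric G) (e : scalar_product R n) (a b : R),
    left_invariant g /\
    forall p : G, let k := a + b * riemannian_dist g 1%g p in
      0 < k /\ forall u : 'rV[R]_n,
        sp_norm e u / k <= sp_norm e (Ad p u) <= k * sp_norm e u.

Definition is_subgroup (G : groupType) (H : set G) : Prop :=
  H 1%g /\ forall x y, H x -> H y -> H (x * y^-1)%g.

(* Indexed from 0: lower_central G 0 is G, lower_central G 1 is [G, G]. *)
Fixpoint lower_central (G : groupType) (k : nat) : set G :=
  match k with
  | 0%N => setT
  | j.+1 => smallest (@is_subgroup G)
      [set [~ x, y]%g | x in [set: G] & y in @lower_central G j]
  end.
Arguments lower_central : clear implicits.

(* Nilpotent of class exactly m. *)
Definition step_nilpotent (m : nat) (G : groupType) : Prop :=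
  lower_central G m = [set 1%g] /\
  forall k, (k < m)%N -> lower_central G k <> [set 1%g].

(* Main.v *)
From HB Require Import structures.
Require Import Defs.
From mathcomp Require Import all_boot all_order all_algebra.
From mathcomp Require Import all_classical all_reals all_analysis.
From mathcomp Require Import lra ring.

Set Implicit Arguments.
Unset Strict Implicit.
Unset Printing Implicit Defensive.

Import Order.TTheory GRing.Theory Num.Theory.
Import numFieldNormedType.Exports.

Local Open Scope classical_set_scope.
Local Open Scope ring_scope.

(** Write N p = Ad p - 1 and comm p q = p q p^-1 q^-1.  Both directions are
    statements about the operators N p o N q.

    If m <= 2, then comm p (comm q r) = 1 for all r; the derivative in r at 1
    says N p o N q = 0, hence N (p q) = N p + N q, so the matrix entries of N
    are additive homomorphisms from G to R.  Along a curve such a homomorphism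
    has for derivative a fixed linear form evaluated at the velocity
    translated back to 1; for a left-invariant metric it is therefore bounded
    by a constant times the length of the curve (hom_path_bound).  So N p
    grows at most linearly in r(p), and N (p^-1) = - N p gives the lower
    bound.  The metric is the left translate of the standard scalar product
    on the tangent space at 1.

    Conversely, N p is nilpotent, and r(p^k) <= k r(p) because curves can be
    translated and concatenated.  If N p o N p <> 0, then Ad (p^k) contains the
    term 'C(k, 2) (N p)^2 on some vector, which grows quadratically in k.  So
    linear growth forces N p o N p = 0 for all p
    (linear_growth_square_zero).  It remains to see that this forces class at
    most 2.  This is the group version of the fact that a 2-Engel Lie algebra
    over a field of characteristic different from 3 has class at most 2,
    carried out on commutators in G:
    - applying the hypothesis to the products p^+-1 q^+-1 shows that N p and
      N q anticommute, and then N (comm p q) = 2 N p o N q;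
    - hence q |-> comm p (comm p q) has zero differential everywhere, and as G
      is connected it is constant, equal to 1 (two_engel);
    - differentiating comm (p r) (comm (p r) q) = 1 in r at r = 1 yields
      3 N p o N q = 0 (Ad1m_comp_eq0);
    - so Ad (comm p q) = 1, and in a connected group such an element is
      central, again because r |-> comm (comm p q) r has zero differential.

    The differentiations are carried out on words in the group: the maps into
    G that take the value 1 at a point have differentials that add up under
    products and change sign under inversion (germM, germV, germ_conj). *)

(** * Maps of class C^k between normed spaces *)

Section Differentiability.
Variable R : realType.
Implicit Types U V W : normedModType R.

Lemma near_eq_differentiable V W (f g : V -> W) (x : V) :
  (\near x, f x = g x) -> differentiable f x -> differentiable g x.
Proof.
move=> fg df.
have gE : g \o shift x = cst (g x) + 'd f x +o_ 0 id.
  apply/eqaddoP => _/posnumP[e].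
  have /eqaddoP dfo := diff_locally df.
  have fe := dfo e%:num [gt0 of e%:num].
  have fg0 : \forall h \near (0 : V), f (h + x) = g (h + x).
    move: fg; rewrite (near_shift 0) /=; apply: filterS => h.
    by rewrite subr0.
  rewrite -(nbhs_singleton fg).
  by apply: filterS2 fe fg0 => h /[swap] /= fgh; rewrite !fctE /= fgh.
have gd := diff_unique (diff_continuous df) gE.
by apply/diff_locallyP; rewrite gd; split => //; exact: diff_continuous.
Unshelve. all: by end_near. Qed.

Lemma derive_comp U V W (f : U -> V) (g : V -> W) x v :
  differentiable f x -> differentiable g (f x) ->
  'D_v (g \o f) x = 'd g (f x) ('D_v f x).
Proof.
move=> df dg; rewrite !deriveE //; last exact: differentiable_comp.
by rewrite diff_comp.
Qed.

Lemma derive_pair U V W (f : U -> V) (g : U -> W) x v :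
  differentiable f x -> differentiable g x ->
  'D_v (fun y => (f y, g y)) x = ('D_v f x, 'D_v g x).
Proof.
move=> df dg; rewrite !deriveE //; last exact: differentiable_pair.
by rewrite diff_pair.
Qed.

Lemma scale_bilinear V : bilinear_for
    (GRing.Scale.Law.clone _ _ *:%R _) (GRing.Scale.Law.clone _ _ *:%R _)
    (fun (a : R^o) (v : V) => a *: v).
Proof.
split=> [u'|u] a x y /=.
- by rewrite scalerDl scalerA.
- by rewrite scalerDr !scalerA mulrC.
Qed.

Lemma is_diff_scale V (p : R^o * V) :
  is_diff p (fun q : R^o * V => q.1 *: q.2) (fun q => p.1 *: q.2 + q.1 *: p.2).
Proof.
pose bM := bilinear_isBilinear.Build R R^o V V _ _ _ (@scale_bilinear V).
pose b : {bilinear R^o -> V -> V} :=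
  HB.pack (fun (a : R^o) (v : V) => a *: v) bM.
have bc : continuous (fun p => b p.1 p.2) by move=> ?; exact: scale_continuous.
apply: DiffDef; last exact: (diff_bilin p bc).
exact: (differentiable_bilin p bc).
Qed.

Lemma is_diff_scaling V W (a : V -> R^o) (f : V -> W) x :
  differentiable a x -> differentiable f x ->
  is_diff x (fun y => a y *: f y) (fun v => a x *: 'd f x v + 'd a x v *: f x).
Proof.
move=> da df.
have dp : is_diff x (fun y => (a y, f y)) (fun v => ('d a x v, 'd f x v)).
  by apply: is_diff_pair; exact: differentiableP.
exact: (is_diff_comp dp (is_diff_scale (a x, f x))).
Qed.

Lemma derive_scale V W (a : V -> R^o) (f : V -> W) x v :
  differentiable a x -> differentiable f x ->
  'D_v (fun y => a y *: f y) x = a x *: 'D_v f x + 'D_v a x *: f x.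
Proof.
move=> da df; have [dd ddE] := is_diff_scaling da df.
by rewrite (deriveE v dd) ddE !deriveE.
Qed.

End Differentiability.

Section CkCalculus.
Variable R : realType.
Implicit Types U V W : normedModType R.

Lemma Ck_on_sub V W k (f : V -> W) (A B : set V) :
  B `<=` A -> Ck_on k f A -> Ck_on k f B.
Proof.
move=> BA; elim: k f => [|k IH] f /=; first by move=> fA x /BA /fA.
by move=> [dfA DfA]; split=> [x /BA /dfA|v] //; exact: IH.
Qed.

(** Ck_on constrains f at the points of A one by one, so it can be checked on
    pieces of A. *)
Lemma Ck_on_local V W k (f : V -> W) (A : set V) :
  (forall x, A x -> exists2 B, B x & Ck_on k f B) -> Ck_on k f A.
Proof.
elim: k f => [|k IH] f fA /=; first by move=> x /fA[B Bx fB]; exact: fB.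
split=> [x /fA[B Bx [dfB _]]|v]; first exact: dfB.
by apply: IH => x /fA[B Bx [_ DfB]]; exists B => //; exact: DfB.
Qed.

Lemma open_near V (A : set V) (P : V -> Prop) x : open A -> A x ->
  (forall y, A y -> P y) -> \near x, P x.
Proof. by move=> oA Ax AP; apply: filterS (open_nbhs_nbhs (conj oA Ax)). Qed.

Lemma eq_Ck_on V W k (f g : V -> W) (A : set V) : open A ->
  (forall x, A x -> f x = g x) -> Ck_on k f A -> Ck_on k g A.
Proof.
move=> oA; elim: k f g => [|k IH] f g fg /=.
  move=> fA x Ax; have fgx := open_near oA Ax fg.
  rewrite /prop_for /continuous_at -(fg _ Ax).
  apply: cvg_trans (fA x Ax); apply: near_eq_cvg.
  exact: fgx.
move=> [df Df]; split=> [x Ax|v].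
  exact: near_eq_differentiable (open_near oA Ax fg) (df x Ax).
by apply: IH (Df v) => x Ax; exact: near_eq_derive (open_near oA Ax fg).
Qed.

Lemma Ck_onS V W k (f : V -> W) (A : set V) : Ck_on k.+1 f A -> Ck_on k f A.
Proof.
elim: k f => [|k IH] f [df Df] /=.
  by move=> x /df; exact: differentiable_continuous.
by split=> // v; apply: IH; exact: Df.
Qed.

Lemma Ck_on_cst V W k (a : W) (A : set V) : open A -> Ck_on k (fun=> a) A.
Proof.
move=> oA; elim: k a => [|k IH] a /=.
  by move=> x _; exact: cst_continuous.
split=> [x _|v]; first exact: differentiable_cst.
by apply: eq_Ck_on (IH 0) => // x _; rewrite derive_cst.
Qed.

Lemma Ck_on_linear V W k (l : {linear V -> W}) (A : set V) : open A ->
  continuous l -> Ck_on k l A.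
Proof.
move=> oA cl; case: k => [|k] /=; first by move=> x _; exact: cl.
split=> [x _|v]; first exact: linear_differentiable.
apply: eq_Ck_on (Ck_on_cst k (l v) oA) => // x _.
by rewrite deriveE ?diff_lin //; exact: linear_differentiable.
Qed.

Lemma Ck_onD V W k (f g : V -> W) (A : set V) : open A ->
  Ck_on k f A -> Ck_on k g A -> Ck_on k (fun x => f x + g x) A.
Proof.
move=> oA; elim: k f g => [|k IH] f g /=.
  by move=> fA gA x Ax; apply: continuousD; [exact: fA|exact: gA].
move=> [df Df] [dg Dg]; split=> [x Ax|v].
  by apply: differentiableD; [exact: df|exact: dg].
apply: eq_Ck_on (IH _ _ (Df v) (Dg v)) => // x Ax.
by rewrite deriveD //; apply: diff_derivable; [exact: df|exact: dg].
Qed.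

Lemma Ck_on_sum V W k (I : finType) (f : I -> V -> W) (A : set V) : open A ->
  (forall i, Ck_on k (f i) A) -> Ck_on k (fun x => \sum_i f i x) A.
Proof.
move=> oA fA; elim: (index_enum I) => [|i s IH].
  apply: eq_Ck_on (Ck_on_cst k 0 oA) => // x _; by rewrite big_nil.
by apply: eq_Ck_on (Ck_onD oA (fA i) IH) => // x _; rewrite big_cons.
Qed.

Lemma Ck_on_scale V W k (a : V -> R^o) (f : V -> W) (A : set V) : open A ->
  Ck_on k a A -> Ck_on k f A -> Ck_on k (fun x => a x *: f x) A.
Proof.
move=> oA; elim: k a f => [|k IH] a f.
  by move=> aA fA x Ax; apply: continuousZ; [exact: aA|exact: fA].
move=> aA fA; have a0 := Ck_onS aA; have f0 := Ck_onS fA.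
case: aA fA => [da Da] [df Df]; split=> [x Ax|v].
  by have [] := is_diff_scaling (da x Ax) (df x Ax).
apply: eq_Ck_on (Ck_onD oA (IH _ _ a0 (Df v)) (IH _ _ (Da v) f0)) => // x Ax.
by rewrite derive_scale //; [exact: da|exact: df].
Qed.

Lemma Ck_on_pair U V W k (f : U -> V) (g : U -> W) (A : set U) : open A ->
  Ck_on k f A -> Ck_on k g A -> Ck_on k (fun x => (f x, g x)) A.
Proof.
move=> oA; elim: k f g => [|k IH] f g.
  move=> fA gA x Ax; apply: cvg_pair; [exact: fA|exact: gA].
move=> [df Df] [dg Dg]; split=> [x Ax|v].
  by apply: differentiable_pair; [exact: df|exact: dg].
apply: eq_Ck_on (IH _ _ (Df v) (Dg v)) => // x Ax.
by rewrite derive_pair //; [exact: df|exact: dg].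
Qed.

(** Finite dimension, in the form that the chain rule below uses: a spanning
    family together with continuous linear coordinates. *)
Definition has_coordinates W := exists (I : finType) (e : I -> W)
  (l : I -> {linear W -> R^o}),
  (forall i, continuous (l i)) /\ forall w, w = \sum_i l i w *: e i.

(** The induction on k is on the derivative, which the coordinates of V turn
    into a finite sum: the derivative of g \o f along v is the sum over i of
    the i-th coordinate of 'D_v f times 'D_(e i) g \o f. *)
Lemma Ck_on_comp U V W k (f : U -> V) (g : V -> W) (A : set U) (B : set V) :
  has_coordinates V -> open A -> (forall x, A x -> B (f x)) ->
  Ck_on k f A -> Ck_on k g B -> Ck_on k (g \o f) A.
Proof.
move=> [I [e [l [cl lE]]]] oA fAB.
have Ck_lin j i (h : U -> V) : Ck_on j h A -> Ck_on j (l i \o h) A.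
  elim: j h => [|j IH] h /=.
    by move=> hA x Ax; apply: continuous_comp; [exact: hA|exact: cl].
  move=> [dh Dh]; split=> [x Ax|v].
    by apply: differentiable_comp; [exact: dh|exact: linear_differentiable].
  apply: eq_Ck_on (IH _ (Dh v)) => // x Ax.
  rewrite derive_comp ?diff_lin //; first exact: dh.
  exact: linear_differentiable.
elim: k f g fAB => [|k IH] f g fAB fA gB.
  by move=> x Ax; apply: continuous_comp; [exact: fA|exact/gB/fAB].
have fk := Ck_onS fA; case: fA gB => [df Df] [dg Dg].
split=> [x Ax|v].
  by apply: differentiable_comp; [exact: df|exact/dg/fAB].
have S : Ck_on k (fun x => \sum_i (l i \o (fun x => 'D_v f x)) x *:
    ((fun y => 'D_(e i) g y) \o f) x) A.
  apply: Ck_on_sum => // i; apply: Ck_on_scale => //.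
    exact: (Ck_lin k i _ (Df v)).
  exact: (IH _ _ fAB fk (Dg (e i))).
apply: eq_Ck_on S => // x Ax /=.
rewrite derive_comp; [|exact: df|exact/dg/fAB].
rewrite [in RHS](lE ('D_v f x)) linear_sum; apply: eq_bigr => i _.
by rewrite linearZ /= (deriveE (e i) (dg _ (fAB _ Ax))).
Qed.

Lemma has_coordinates_rV n : has_coordinates 'rV[R]_n.
Proof.
exists 'I_n, (fun i => delta_mx 0 i).
have coord_lin i : linear (fun u : 'rV[R]_n => u 0 i : R^o).
  by move=> a u v; rewrite !mxE.
pose l i : {linear 'rV[R]_n -> R^o} :=
  HB.pack (fun u : 'rV[R]_n => u 0 i : R^o)
    (GRing.isLinear.Build _ _ _ _ _ (coord_lin i)).
exists l; split=> [i|w]; first exact: coord_continuous.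
exact: row_sum_delta.
Qed.

Lemma has_coordinates_pair V W : has_coordinates V -> has_coordinates W ->
  has_coordinates (V * W)%type.
Proof.
move=> [I [e [l [cl lE]]]] [J [d [j [cj jE]]]].
exists (I + J)%type, (fun i : I + J => match i with
  inl i => (e i, 0) | inr i => (0, d i) end).
exists (fun i : I + J => match i with
  inl i => (l i \o fst : {linear (V * W)%type -> R^o})
| inr i => (j i \o snd : {linear (V * W)%type -> R^o}) end).
split=> [[i|i] x|[v w]].
- by apply: continuous_comp; [exact: cvg_fst|exact: cl].
- by apply: continuous_comp; [exact: cvg_snd|exact: cj].
rewrite big_sumType /= [LHS]surjective_pairing [RHS]surjective_pairing /=.
congr pair; rewrite !raddf_sum /=.
  rewrite [X in _ + X]big1 ?addr0; last by move=> i _; rewrite scaler0.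
  exact: lE.
rewrite [X in X + _]big1 ?add0r; last by move=> i _; rewrite scaler0.
exact: jE.
Qed.

End CkCalculus.

(** * Maps from a normed space into a manifold *)

Lemma open_setI_preimage (S T : topologicalType) (F : S -> T) (A : set S)
    (B : set T) : open A -> (forall x, A x -> {for x, continuous F}) ->
  open B -> open (A `&` F @^-1` B).
Proof.
move=> oA cF oB; rewrite openE => x [Ax Bx].
apply: filterI; first exact: open_nbhs_nbhs.
by apply: (cF x Ax); exact: open_nbhs_nbhs.
Qed.

Lemma open_setX (S T : topologicalType) (A : set S) (B : set T) :
  open A -> open B -> open (A `*` B).
Proof.
move=> oA oB; rewrite openE => -[x y] /= [Ax By].
by exists (A, B) => //; split=> /=; exact: open_nbhs_nbhs.
Qed.

Section MapsIntoManifolds.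
Variables (R : realType).
Implicit Types (U V : normedModType R) (n : nat).

(** Charts other than the preferred one at F x give the same notion, see
    mdifferentiable_chart and chart_mdifferentiable. *)
Definition mdifferentiable V n (M : manifoldType R n) (F : V -> M) (x : V) :=
  {for x, continuous F} /\ differentiable (chart_at (F x) \o F) x.

(** The value is a tangent vector at F x.  The velocity of a curve, the vectors
    coord_vector and the differential mdiff are all instances, for F a curve,
    a chart inverse, and a map precomposed with a chart inverse. *)
Definition mD V n (M : manifoldType R n) (F : V -> M) (x v : V) : 'rV[R]_n :=
  'D_v (chart_at (F x) \o F) x.

(** With V the real line and k = 1 this is the condition in C1_arc. *)
Definition Ck_into V n (M : manifoldType R n) k (F : V -> M) (A : set V) :=
  (forall x, A x -> {for x, continuous F}) /\
  forall f : chart R n M, atlas f ->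
    Ck_on k (f \o F) (A `&` F @^-1` chart_dom f).

Lemma continuous_near_dom V n (M : manifoldType R n) (F : V -> M) x
    (f : chart R n M) : {for x, continuous F} -> chart_dom f (F x) ->
  \forall y \near x, chart_dom f (F y).
Proof.
move=> cF dFx; apply: cF; apply: open_nbhs_nbhs; split=> //.
exact: chart_dom_open.
Qed.

Lemma transition_differentiable n (M : manifoldType R n) (f g : chart R n M) p :
  atlas f -> atlas g -> chart_dom f p -> chart_dom g p ->
  differentiable (g \o chart_inv f) (f p).
Proof.
move=> af ag fp gp; have [+ _] := atlas_compatible f g af ag 1; apply.
by split; [exact: chart_fun_cod|rewrite /= chart_funK].
Qed.

(** Near x, the map g \o F is the transition map g \o chart_inv f after f \o F;
    continuity of F at x is what makes this hold in a neighbourhood. *)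
Lemma change_chart V n (M : manifoldType R n) (F : V -> M) x
    (f g : chart R n M) : atlas f -> atlas g -> {for x, continuous F} ->
  chart_dom f (F x) -> chart_dom g (F x) -> differentiable (f \o F) x ->
  differentiable (g \o F) x /\ forall v,
  'D_v (g \o F) x = 'd (g \o chart_inv f) (f (F x)) ('D_v (f \o F) x).
Proof.
move=> af ag cF fx gx df.
have dt := transition_differentiable af ag fx gx.
have E : \forall y \near x, ((g \o chart_inv f) \o (f \o F)) y = (g \o F) y.
  by apply: filterS (continuous_near_dom cF fx) => y fy; rewrite /= chart_funK.
split=> [|v].
  by apply: near_eq_differentiable E _; exact: differentiable_comp.
by rewrite -(near_eq_derive v E) derive_comp.
Qed.

Lemma mdifferentiable_chart V n (M : manifoldType R n) (F : V -> M) x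
    (f : chart R n M) : atlas f -> chart_dom f (F x) -> mdifferentiable F x ->
  differentiable (f \o F) x /\ forall v, 'D_v (f \o F) x =
    'd (f \o chart_inv (chart_at (F x))) (chart_at (F x) (F x)) (mD F x v).
Proof.
move=> af fx [cF dF]; apply: change_chart => //; first exact: chart_at_atlas.
exact: chart_at_dom.
Qed.

Lemma chart_mdifferentiable V n (M : manifoldType R n) (F : V -> M) x
    (f : chart R n M) : atlas f -> {for x, continuous F} ->
  chart_dom f (F x) -> differentiable (f \o F) x -> mdifferentiable F x.
Proof.
move=> af cF fx df; split=> //.
have [] // := @change_chart _ _ _ F x f (chart_at (F x)) af.
  exact: chart_at_atlas.
exact: chart_at_dom.
Qed.

Lemma near_eq_mdifferentiable V n (M : manifoldType R n) (F H : V -> M) x :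
  (\near x, F x = H x) -> mdifferentiable F x -> mdifferentiable H x.
Proof.
move=> FH [cF dF]; rewrite /mdifferentiable -(nbhs_singleton FH); split.
  rewrite /prop_for /continuous_at -(nbhs_singleton FH).
  by apply: cvg_trans cF; exact: near_eq_cvg.
by apply: near_eq_differentiable dF; apply: filterS FH => y /= ->.
Qed.

Lemma near_eq_mD V n (M : manifoldType R n) (F H : V -> M) x v :
  (\near x, F x = H x) -> mD F x v = mD H x v.
Proof.
move=> FH; rewrite /mD -(nbhs_singleton FH); apply: near_eq_derive.
by apply: filterS FH => y /= ->.
Qed.

Lemma mD_linear V n (M : manifoldType R n) (F : V -> M) x :
  mdifferentiable F x -> linear (mD F x).
Proof. by move=> [_ dF] a u v; rewrite /mD !deriveE // linearP. Qed.

Lemma mdifferentiable_comp U V n (M : manifoldType R n) (F : V -> M)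
    (h : U -> V) x : differentiable h x -> mdifferentiable F (h x) ->
  mdifferentiable (F \o h) x.
Proof.
move=> dh [cF dF]; split.
  by apply: continuous_comp => //; exact: differentiable_continuous.
exact: (@differentiable_comp _ _ _ _ h (chart_at (F (h x)) \o F)).
Qed.

Lemma mD_comp U V n (M : manifoldType R n) (F : V -> M)
    (h : U -> V) x v : differentiable h x -> mdifferentiable F (h x) ->
  mD (F \o h) x v = mD F (h x) ('D_v h x).
Proof.
move=> dh [cF dF]; rewrite /mD -[_ \o (F \o h)]/((_ \o F) \o h).
by rewrite derive_comp // !deriveE.
Qed.

Lemma near_chart_cod n (M : manifoldType R n) (f : chart R n M) x :
  chart_cod f x -> \forall y \near x, f (chart_inv f y) = y.
Proof.
move=> fx.
apply: filterS (open_nbhs_nbhs (conj (@chart_cod_open _ _ _ f) fx)) => y.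
exact: chart_invK.
Qed.

Lemma mdifferentiable_chart_inv n (M : manifoldType R n) (f : chart R n M) x :
  atlas f -> chart_cod f x -> mdifferentiable (chart_inv f) x.
Proof.
move=> af fx; apply: (chart_mdifferentiable af).
- exact: chart_inv_continuous.
- exact: chart_inv_dom.
- apply: (@near_eq_differentiable _ _ _ id); last exact: ex_diff.
  by apply: filterS (near_chart_cod fx) => y /= ->.
Qed.

Lemma mD_chart_at n (M : manifoldType R n) (p : M) v :
  mD (chart_inv (chart_at p)) (chart_at p p) v = v.
Proof.
rewrite /mD chart_funK; last exact: chart_at_dom.
rewrite -[RHS](derive_id (chart_at p p)); apply: near_eq_derive.
apply: near_chart_cod; apply: chart_fun_cod; exact: chart_at_dom.
Qed.

Definition mdiffable n k (M : manifoldType R n) (N : manifoldType R k)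
    (T : M -> N) (p : M) := {for p, continuous T} /\
  differentiable (chart_at (T p) \o T \o chart_inv (chart_at p)) (chart_at p p).

Section Compose.
Variables (V : normedModType R) (n k : nat).
Variables (M : manifoldType R n) (N : manifoldType R k).
Variables (T : M -> N) (F : V -> M) (x : V).
Hypotheses (dF : mdifferentiable F x) (dT : mdiffable T (F x)).

Let nearE : \forall y \near x,
  ((chart_at (T (F x)) \o T \o chart_inv (chart_at (F x)))
    \o (chart_at (F x) \o F)) y = (chart_at (T (F x)) \o (T \o F)) y.
Proof.
have [cF _] := dF.
apply: filterS (continuous_near_dom cF (chart_at_dom (F x))) => y fy /=.
by rewrite chart_funK.
Qed.

Lemma mdifferentiable_mdiff : mdifferentiable (T \o F) x.
Proof.
have [[cF dF'] [cT dT']] := (dF, dT).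
split; first by apply: continuous_comp.
by apply: near_eq_differentiable nearE _; exact: differentiable_comp.
Qed.

Lemma mD_mdiff v : mD (T \o F) x v = mdiff T (F x) (mD F x v).
Proof.
have [[cF dF'] [cT dT']] := (dF, dT).
rewrite /mD [LHS](_ : _ = 'D_v (chart_at (T (F x)) \o (T \o F)) x) //.
rewrite -(near_eq_derive v nearE) derive_comp //.
by rewrite /mdiff (deriveE _ dT').
Qed.

End Compose.

Lemma mdiff_linear n k (M : manifoldType R n) (N : manifoldType R k)
    (T : M -> N) (p : M) : mdiffable T p -> linear (mdiff T p).
Proof. by move=> [_ dT] a u v; rewrite /mdiff !deriveE // linearP. Qed.

Lemma Ck_into_cst V n (M : manifoldType R n) k (p : M) (A : set V) :
  open A -> Ck_into k (fun=> p) A.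
Proof.
move=> oA; split=> [x _|f _]; first exact: cst_continuous.
apply: Ck_on_cst; apply: open_setI_preimage (@chart_dom_open _ _ _ f) => // x _.
exact: cst_continuous.
Qed.

Lemma Ck_into_comp U V n (M : manifoldType R n) k (F : V -> M) (h : U -> V)
    (A : set U) (B : set V) : has_coordinates V -> open A ->
  (forall x, A x -> B (h x)) -> (forall j, (j <= k)%N -> Ck_on j h A) ->
  Ck_into k F B -> Ck_into k (F \o h) A.
Proof.
move=> Vc oA hAB hA [cF dF].
have cFh x : A x -> {for x, continuous (F \o h)}.
  by move=> Ax; apply: continuous_comp; [exact: (hA 0%N)|exact/cF/hAB].
split=> // f af.
apply: (@Ck_on_comp _ _ _ _ k h (f \o F) _ _ Vc _ _ _ (dF f af)).
- by apply: open_setI_preimage (@chart_dom_open _ _ _ f).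
- by move=> x [Ax fx]; split=> //; exact: hAB.
- by apply: Ck_on_sub (hA k _) => // x [].
Qed.

Lemma Ck_into_chart_inv n (M : manifoldType R n) k (f : chart R n M) :
  atlas f -> Ck_into k (chart_inv f) (chart_cod f).
Proof.
move=> af; split=> [|g ag]; first exact: chart_inv_continuous.
exact: atlas_compatible.
Qed.

Lemma Ck_into_fst n (M : manifoldType R n) k (f : chart R n M) :
  atlas f -> Ck_into k (fun z : 'rV[R]_n * 'rV[R]_n => chart_inv f z.1)
    (chart_cod f `*` chart_cod f).
Proof.
move=> af.
have oA : open (chart_cod f `*` chart_cod f).
  by apply: open_setX; exact: chart_cod_open.
apply: (Ck_into_comp (h := fst) _ _ _ _ (Ck_into_chart_inv k af)) => //.
- exact: has_coordinates_rV.
- by move=> x [].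
- by move=> j _; apply: Ck_on_linear => // ?; exact: cvg_fst.
Qed.

Lemma Ck_into_snd n (M : manifoldType R n) k (f : chart R n M) :
  atlas f -> Ck_into k (fun z : 'rV[R]_n * 'rV[R]_n => chart_inv f z.2)
    (chart_cod f `*` chart_cod f).
Proof.
move=> af.
have oA : open (chart_cod f `*` chart_cod f).
  by apply: open_setX; exact: chart_cod_open.
apply: (Ck_into_comp (h := snd) _ _ _ _ (Ck_into_chart_inv k af)) => //.
- exact: has_coordinates_rV.
- by move=> x [].
- by move=> j _; apply: Ck_on_linear => // ?; exact: cvg_snd.
Qed.

Lemma Ck_into_mdifferentiable V n (M : manifoldType R n) k (F : V -> M)
    (A : set V) x : Ck_into k.+1 F A -> A x -> mdifferentiable F x.
Proof.
move=> [cF dF] Ax; split; first exact: cF.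
have [+ _] := dF _ (chart_at_atlas (F x)); apply; split=> //.
exact: chart_at_dom.
Qed.

(** Smoothness of T is only known in charts, so the composite is cut into
    pieces on which F and H take their values in fixed charts. *)
Lemma Ck_into_map2 V n1 n2 n3 (M1 : manifoldType R n1) (M2 : manifoldType R n2)
    (N : manifoldType R n3) (T : M1 -> M2 -> N) k (F : V -> M1) (H : V -> M2)
    (A : set V) : smooth_map2 T -> open A ->
  Ck_into k F A -> Ck_into k H A -> Ck_into k (fun x => T (F x) (H x)) A.
Proof.
move=> [cT sT] oA [cF dF] [cH dH].
have cTFH x : A x -> {for x, continuous (fun x => T (F x) (H x))}.
  move=> Ax.
  have cFH : {for x, continuous (fun x => (F x, H x))}.
    by apply: cvg_pair; [exact: cF|exact: cH].
  exact: (@continuous_comp _ _ _ _ (fun z : M1 * M2 => T z.1 z.2) x cFH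
    (cT (F x, H x))).
split=> // f af; apply: Ck_on_local => x [Ax fx].
pose k1 := chart_at (F x); pose k2 := chart_at (H x).
pose B := (A `&` F @^-1` chart_dom k1) `&` (A `&` H @^-1` chart_dom k2)
  `&` (A `&` (fun x => T (F x) (H x)) @^-1` chart_dom f).
have oB : open B.
  apply: openI; first apply: openI.
  - exact: open_setI_preimage oA cF (@chart_dom_open _ _ _ k1).
  - exact: open_setI_preimage oA cH (@chart_dom_open _ _ _ k2).
  - exact: open_setI_preimage oA cTFH (@chart_dom_open _ _ _ f).
exists B; first by do !split => //; exact: chart_at_dom.
have E y : B y -> ((fun z => f (T (chart_inv k1 z.1) (chart_inv k2 z.2))) \o
    (fun y => ((k1 \o F) y, (k2 \o H) y))) y
    = (f \o (fun x => T (F x) (H x))) y.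
  by move=> [[[_ Fy] [_ Hy]] _] /=; rewrite !chart_funK.
apply: eq_Ck_on E _ => //.
apply: (Ck_on_comp _ _ _ _
  (sT k1 k2 f (chart_at_atlas _) (chart_at_atlas _) af k)) => //.
- by apply: has_coordinates_pair; exact: has_coordinates_rV.
- move=> y [[[_ Fy] [_ Hy]] [_ fy]]; split=> /=.
    by split; exact: chart_fun_cod.
  by rewrite !chart_funK.
- apply: Ck_on_pair => //.
    by apply: Ck_on_sub (dF k1 (chart_at_atlas _)) => y [[]].
  by apply: Ck_on_sub (dH k2 (chart_at_atlas _)) => y [[_ []]].
Qed.

Lemma Ck_into_map V n1 n3 (M1 : manifoldType R n1)
    (N : manifoldType R n3) (T : M1 -> N) k (F : V -> M1)
    (A : set V) : smooth_map T -> open A ->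
  Ck_into k F A -> Ck_into k (T \o F) A.
Proof.
move=> [cT sT] oA [cF dF].
have cTF x : A x -> {for x, continuous (T \o F)}.
  by move=> Ax; apply: continuous_comp; [exact: cF|exact: cT].
split=> // f af; apply: Ck_on_local => x [Ax fx].
pose k1 := chart_at (F x).
pose B := (A `&` F @^-1` chart_dom k1) `&` (A `&` (T \o F) @^-1` chart_dom f).
have oB : open B.
  apply: openI.
  - exact: open_setI_preimage oA cF (@chart_dom_open _ _ _ k1).
  - exact: open_setI_preimage oA cTF (@chart_dom_open _ _ _ f).
exists B; first by do !split => //; exact: chart_at_dom.
have E y : B y -> ((f \o T \o chart_inv k1) \o (k1 \o F)) y
    = (f \o (T \o F)) y.
  by move=> [[_ Fy] _] /=; rewrite !chart_funK.
apply: eq_Ck_on E _ => //.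
apply: (Ck_on_comp _ _ _ _ (sT k1 f (chart_at_atlas _) af k)) => //.
- exact: has_coordinates_rV.
- move=> y [[_ Fy] [_ fy]]; split=> /=; first exact: chart_fun_cod.
  by rewrite !chart_funK.
- by apply: Ck_on_sub (dF k1 (chart_at_atlas _)) => y [[]].
Qed.

End MapsIntoManifolds.

(** * Maps with vanishing differential *)

(** The fibre of a point is open, and so is its complement. *)
Lemma connected_locally_constant (S : topologicalType) (X : Type) (f : S -> X) :
  connected [set: S] -> (forall p, \forall q \near p, f q = f p) ->
  forall p q, f p = f q.
Proof.
move=> cS lc p q.
have open_fib A : open [set r | A (f r)].
  rewrite openE => r /= Ar; apply: filterS (lc r) => s /= ->; exact: Ar.
have /(congr1 (fun B => B q)) : [set r | f r = f p] = [set: S].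
  apply: cS; first by exists p.
    exists [set r | f r = f p]; last by rewrite setTI.
    exact: (open_fib (eq^~ (f p))).
  exists [set r | f r = f p]; last by rewrite setTI.
  rewrite -openC; exact: (open_fib (fun z => z <> f p)).
by move=> /= E; rewrite (_ : f q = f p) // E.
Qed.

Section ZeroDifferential.
Variable R : realType.

(** The mean value theorem holds for real functions only, so it is applied to
    each coordinate of h along the segment. *)
Lemma diff0_segment (V : normedModType R) n (h : V -> 'rV[R]_n) (x y : V) :
  (forall t : R, 0 <= t <= 1 -> is_diff (x + t *: (y - x)) h 0) -> h x = h y.
Proof.
move=> dh; pose s t := x + t *: (y - x).
have ds (t : R^o) : is_diff t s (fun u => u *: (y - x)).
  apply: is_diff_eq
    (is_diffD (is_diff_cst x t) (is_diff_scalel t (y - x))) _.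
  by apply/funext => u; rewrite !fctE /= add0r.
have dhs (t : R) : 0 <= t <= 1 -> is_diff (t : R^o) (h \o s) 0.
  move=> t01; apply: is_diff_eq (is_diff_comp (ds t) (dh t t01)) _.
  by apply/funext => u.
apply/rowP => i; pose k (t : R) := h (s t) 0 i.
have dk (t : R) : 0 <= t <= 1 -> is_diff (t : R^o) (k : R^o -> R^o) 0.
  move=> t01.
  have dc : differentiable (fun u : 'rV[R]_n => u 0 i : R^o) (h (s t)).
    exact: differentiable_coord.
  apply: is_diff_eq (is_diff_comp (dhs t t01) (differentiableP dc)) _.
  by apply/funext => u; rewrite !fctE /= linear0.
have [||c _] := @MVT_segment R k (fun=> 0) 0 1 ler01.
- move=> t; rewrite in_itv /= => /andP[t0 t1].
  have [d1 d2] := dk t (ltac:(by rewrite !ltW)).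
  apply: DeriveDef; first exact: diff_derivable.
  by rewrite deriveE // d2.
- apply: continuous_in_subspaceT => t; rewrite inE /= in_itv /= => t01.
  by apply: differentiable_continuous; have [] := dk t t01.
rewrite mul0r => /subr0_eq; rewrite /k /s scale1r scale0r addr0 subrKC.
by move->.
Qed.

(** T is constant near each point by diff0_segment on a ball in a chart, and
    locally constant maps on a connected space are constant. *)
Lemma zero_differential_constant n k (M : manifoldType R n)
    (N : manifoldType R k) (T : M -> N) : connected [set: M] ->
  (forall (f : chart R n M) x, atlas f -> chart_cod f x ->
    mdifferentiable (T \o chart_inv f) x /\
    forall v, mD (T \o chart_inv f) x v = 0) ->
  forall p q, T p = T q.
Proof.
move=> cM dT; apply: connected_locally_constant => // p.
pose f := chart_at p; pose g := chart_at (T p).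
have fp : chart_cod f (f p) by apply: chart_fun_cod; exact: chart_at_dom.
have af : atlas f by exact: chart_at_atlas.
have ag : atlas g by exact: chart_at_atlas.
have [[cT _] _] := dT f _ af fp.
have gT : chart_dom g ((T \o chart_inv f) (f p)).
  by rewrite /= chart_funK; exact: chart_at_dom.
have near1 := continuous_near_dom cT gT.
have near2 := open_nbhs_nbhs (conj (@chart_cod_open _ _ _ f) fp).
have [r /= r0 rP] := (nbhs_ballP (f p) _).1 (filterI near1 near2).
have cf : {for p, continuous f}.
  by apply: chart_fun_continuous; exact: chart_at_dom.
have nearB : \forall q \near p, ball (f p) r (f q).
  by apply: cf; exact: nbhsx_ballx.
have nearD : \forall q \near p, chart_dom f q.
  by apply: open_nbhs_nbhs; split; [exact: chart_dom_open|exact: chart_at_dom].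
apply: filterS2 nearB nearD => q Bq Dq.
suff E : g (T (chart_inv f (f q))) = g (T (chart_inv f (f p))).
  have [gq _] := rP _ Bq; have [gp _] := rP _ (ballxx (f p) r0).
  have := congr1 (chart_inv g) E; rewrite (chart_funK gq) (chart_funK gp) /=.
  by rewrite (chart_funK Dq) (chart_funK (chart_at_dom p)).
apply/esym.
apply: (@diff0_segment _ _ (g \o T \o chart_inv f)) => t /andP[t0 t1].
set z := _ + _.
have Bz : ball (f p) r z.
  move: Bq; rewrite -!ball_normE /= /z opprD addrA subrr sub0r normrN normrZ.
  rewrite ger0_norm // distrC; apply: le_lt_trans.
  by rewrite ler_piMl.
have [gz fz] := rP _ Bz; have [dz Dz] := dT f z af fz.
have [dgz Dgz] := mdifferentiable_chart ag gz dz.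
apply: DiffDef; first exact: dgz.
apply/funext => v; rewrite -deriveE; last exact: dgz.
by rewrite Dgz Dz linear0.
Qed.

End ZeroDifferential.

(** * Differentials of words in a Lie group *)

Section LieGroupCalculus.
Variables (R : realType) (n : nat) (G : lieGroupType R n).
Implicit Types (V : normedModType R) (p q a : G).

Lemma Ck_into_mul V k (F H : V -> G) (A : set V) : open A ->
  Ck_into k F A -> Ck_into k H A -> Ck_into k (fun x => F x * H x)%g A.
Proof. by move=> oA; apply: Ck_into_map2 => //; exact: mulg_smooth. Qed.

Lemma Ck_into_inv V k (F : V -> G) (A : set V) : open A ->
  Ck_into k F A -> Ck_into k (fun x => (F x)^-1)%g A.
Proof. by move=> oA; apply: Ck_into_map => //; exact: invg_smooth. Qed.

Lemma continuous_mulg (T : topologicalType) (F H : T -> G) x :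
  {for x, continuous F} -> {for x, continuous H} ->
  {for x, continuous (fun y => F y * H y)%g}.
Proof.
move=> cF cH; have [cm _] := @mulg_smooth R n G.
have cFH : {for x, continuous (fun x => (F x, H x))} by exact: cvg_pair.
exact: (@continuous_comp _ _ _ _ (fun z : G * G => z.1 * z.2)%g x cFH
    (cm (F x, H x))).
Qed.

Lemma mdiffE (k l : nat) (M : manifoldType R k) (N : manifoldType R l)
    (T : M -> N) (p : M) u :
  mdiff T p u = mD (T \o chart_inv (chart_at p)) (chart_at p p) u.
Proof. by rewrite /mD /= chart_funK //; exact: chart_at_dom. Qed.

Lemma Ck_into_mdiffable (k l : nat) (M : manifoldType R k)
    (N : manifoldType R l) (T : M -> N) (p : M) : {for p, continuous T} ->
  Ck_into 1 (T \o chart_inv (chart_at p)) (chart_cod (chart_at p)) ->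
  mdiffable T p.
Proof.
move=> cT dT; split=> //.
have /(Ck_into_mdifferentiable dT)[_] : chart_cod (chart_at p) (chart_at p p).
  by apply: chart_fun_cod; exact: chart_at_dom.
by rewrite /= chart_funK //; exact: chart_at_dom.
Qed.

Lemma mdiff_comp (k l j : nat) (M : manifoldType R k) (N : manifoldType R l)
    (L : manifoldType R j) (S : M -> N) (T : N -> L) (p : M) u :
  mdiffable S p -> mdiffable T (S p) ->
  mdiff (T \o S) p u = mdiff T (S p) (mdiff S p u).
Proof.
move=> dS dT; rewrite !(mdiffE _ p) -compA.
have pK : (S \o chart_inv (chart_at p)) (chart_at p p) = S p.
  by rewrite /= chart_funK //; exact: chart_at_dom.
rewrite (mD_mdiff (F := S \o chart_inv (chart_at p))) ?pK //.
have [cS dS'] := dS.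
split; last by rewrite pK.
apply: continuous_comp; last by rewrite chart_funK //; exact: chart_at_dom.
apply: chart_inv_continuous; apply: chart_fun_cod; exact: chart_at_dom.
Qed.

Lemma mdiff_id (k : nat) (M : manifoldType R k) (p : M) u :
  mdiff (fun x : M => x) p u = u.
Proof. by rewrite mdiffE mD_chart_at. Qed.

Lemma mdiff0 (k l : nat) (M : manifoldType R k) (N : manifoldType R l)
    (T : M -> N) (p : M) : mdiffable T p -> mdiff T p 0 = 0.
Proof. by move=> [_ dT]; rewrite /mdiff deriveE // linear0. Qed.

Lemma mdiffable_lmul a p : mdiffable (fun x : G => a * x)%g p.
Proof.
apply: Ck_into_mdiffable.
  apply: continuous_mulg; [exact: cst_continuous|exact: cvg_id].
have oc := @chart_cod_open _ _ _ (chart_at p).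
apply: Ck_into_mul => //; first exact: Ck_into_cst.
by apply: Ck_into_chart_inv; exact: chart_at_atlas.
Qed.

Lemma mdiffable_conj a p : mdiffable (fun x : G => a * x * a^-1)%g p.
Proof.
apply: Ck_into_mdiffable.
  apply: continuous_mulg; last exact: cst_continuous.
  apply: continuous_mulg; [exact: cst_continuous|exact: cvg_id].
have oc := @chart_cod_open _ _ _ (chart_at p).
apply: Ck_into_mul => //; last exact: Ck_into_cst.
apply: Ck_into_mul => //; first exact: Ck_into_cst.
by apply: Ck_into_chart_inv; exact: chart_at_atlas.
Qed.

Lemma Ad_linear p : linear (Ad p).
Proof. by apply: mdiff_linear; exact: mdiffable_conj. Qed.

Lemma AdM p q u : Ad (p * q)%g u = Ad p (Ad q u).
Proof.
rewrite /Ad [X in mdiff X](_ : _ =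
    (fun x : G => p * x * p^-1)%g \o (fun x : G => q * x * q^-1)%g); last first.
  by apply/funext => x /=; rewrite invgM !mulgA.
rewrite mdiff_comp ?mulg1 ?mulgV //; exact: mdiffable_conj.
Qed.

Lemma Ad1 u : Ad (1 : G)%g u = u.
Proof.
rewrite /Ad [X in mdiff X](_ : _ = (fun x : G => x)) ?mdiff_id //.
by apply/funext => x /=; rewrite mul1g invg1 mulg1.
Qed.

(** Maps to G with value 1 at x: their differentials all lie in the tangent
    space at 1, so that they can be added. *)
Definition germ V (F : V -> G) x (L : V -> 'rV[R]_n) :=
  [/\ F x = 1%g, mdifferentiable F x & forall v, mD F x v = L v].

Lemma germ_near V (F H : V -> G) x L : (\near x, F x = H x) ->
  germ F x L -> germ H x L.
Proof.
move=> FH [F1 dF DF]; split.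
- by rewrite -(nbhs_singleton FH).
- exact: near_eq_mdifferentiable FH dF.
- by move=> v; rewrite -(near_eq_mD v FH).
Qed.

Lemma germ_unique V (F : V -> G) x L L' v : germ F x L -> germ F x L' ->
  L v = L' v.
Proof. by move=> [_ _ <-] [_ _ <-]. Qed.

Lemma germ_one V (x : V) : germ (fun=> 1%g) x 0.
Proof.
split=> //; last by move=> v; exact: derive_cst.
by split; [exact: cst_continuous|exact: differentiable_cst].
Qed.

(** The generic variable: composing a word with it computes the differential of
    the word at 1. *)
Lemma germ_chart :
  germ (chart_inv (chart_at (1 : G)%g)) (chart_at (1 : G)%g 1%g) id.
Proof.
split; first by rewrite chart_funK //; exact: chart_at_dom.
- apply: mdifferentiable_chart_inv; first exact: chart_at_atlas.
  by apply: chart_fun_cod; exact: chart_at_dom.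
- by move=> v; exact: mD_chart_at.
Qed.

Lemma germ_conj V (F : V -> G) x L p : germ F x L ->
  germ (fun y => p * F y * p^-1)%g x (Ad p \o L).
Proof.
move=> [F1 dF DF].
have dp : mdiffable (fun x => p * x * p^-1)%g (F x) by exact: mdiffable_conj.
split=> [||v]; first by rewrite F1 mulg1 mulgV.
  exact: (mdifferentiable_mdiff dF dp).
by rewrite (mD_mdiff dF dp) F1 DF.
Qed.

Let e := chart_at (1 : G)%g 1%g.
Let c := chart_at (1 : G)%g.
Let mulc (z : 'rV[R]_n * 'rV[R]_n) := (chart_inv c z.1 * chart_inv c z.2)%g.

Let ce : chart_cod c e.
Proof. by apply: chart_fun_cod; exact: chart_at_dom. Qed.

Let ocod : open (chart_cod c `*` chart_cod c).
Proof. by apply: open_setX; exact: chart_cod_open. Qed.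

Let mulc_smooth : Ck_into 1 mulc (chart_cod c `*` chart_cod c).
Proof.
have ac : atlas c by exact: chart_at_atlas.
by apply: Ck_into_mul ocod _ _; [exact: Ck_into_fst|exact: Ck_into_snd].
Qed.

Let mulc_mdiff : mdifferentiable mulc (e, e).
Proof. by apply: Ck_into_mdifferentiable mulc_smooth _. Qed.

Let mulcE u v : mD mulc (e, e) (u, v) = u + v.
Proof.
have chart1 : chart_inv c e = 1%g by rewrite chart_funK //; exact: chart_at_dom.
have D1 : mD mulc (e, e) (u, 0) = u.
  have d1 : is_diff e (fun x : 'rV[R]_n => (x, e)) (fun v => (v, 0)).
    by apply: is_diff_pair.
  have := mD_comp u (@ex_diff _ _ _ _ _ _ _ d1) mulc_mdiff.
  rewrite deriveE; last by have [] := d1.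
  rewrite diff_val => <-; rewrite -[RHS](mD_chart_at (1 : G)%g u).
  by apply: near_eq_mD; near=> y; rewrite /= /mulc /= chart1 mulg1.
have D2 : mD mulc (e, e) (0, v) = v.
  have d1 : is_diff e (fun x : 'rV[R]_n => (e, x)) (fun v => (0, v)).
    by apply: is_diff_pair.
  have := mD_comp v (@ex_diff _ _ _ _ _ _ _ d1) mulc_mdiff.
  rewrite deriveE; last by have [] := d1.
  rewrite diff_val => <-; rewrite -[RHS](mD_chart_at (1 : G)%g v).
  by apply: near_eq_mD; near=> y; rewrite /= /mulc /= chart1 mul1g.
rewrite (_ : (u, v) = 1 *: (u, 0) + (0, v)); last first.
  by rewrite scale1r /GRing.add /= /add_pair /= addr0 add0r.
by rewrite (mD_linear mulc_mdiff) D1 D2 scale1r.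
Unshelve. all: by end_near. Qed.

(** The differential of the multiplication at (1, 1) is the addition, since
    its restrictions to the two factors are identities. *)
Lemma germM V (F H : V -> G) x L L' : germ F x L -> germ H x L' ->
  germ (fun y => F y * H y)%g x (fun v => L v + L' v).
Proof.
move=> [F1 [cF dF] DF] [H1 [cH dH] DH].
pose h y := (c (F y), c (H y)).
have dcF : differentiable (c \o F) x by move: dF; rewrite F1.
have dcH : differentiable (c \o H) x by move: dH; rewrite H1.
have dh : differentiable h x by exact: differentiable_pair.
have hx : h x = (e, e) by rewrite /h F1 H1.
have dm : mdifferentiable mulc (h x) by rewrite hx.
have E : \forall y \near x, (mulc \o h) y = (F y * H y)%g.
  have nF : \forall y \near x, chart_dom c (F y).
    by apply: continuous_near_dom => //; rewrite F1; exact: chart_at_dom.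
  have nH : \forall y \near x, chart_dom c (H y).
    by apply: continuous_near_dom => //; rewrite H1; exact: chart_at_dom.
  by apply: filterS2 nF nH => y Fy Hy; rewrite /mulc /= !chart_funK.
apply: (germ_near E); split.
- by rewrite (nbhs_singleton E) F1 H1 mulg1.
- exact: mdifferentiable_comp.
- move=> v; rewrite mD_comp // hx derive_pair // mulcE.
  by rewrite -DF -DH /mD F1 H1.
Qed.

(** F times its inverse is the constant 1, so the two differentials
    add up to 0. *)
Lemma germV V (F : V -> G) x L : germ F x L ->
  germ (fun y => (F y)^-1)%g x (fun v => - L v).
Proof.
move=> gF; have [F1 [cF dF] DF] := gF.
have [Vc Vd] : mdiffable (fun p : G => p^-1)%g (F x).
  apply: Ck_into_mdiffable; first by have [+ _] := @invg_smooth R n G; apply.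
  apply: Ck_into_inv; first exact: chart_cod_open.
  by apply: Ck_into_chart_inv; exact: chart_at_atlas.
have [gV1 gV2] : (F x)^-1%g = 1%g /\ mdifferentiable (fun y => (F y)^-1)%g x.
  split; first by rewrite F1 invg1.
  exact: (mdifferentiable_mdiff (T := fun p : G => p^-1)%g).
have gV : germ (fun y => (F y)^-1)%g x (mD (fun y => (F y)^-1)%g x) by [].
split=> // v.
have := germM gF gV; rewrite [X in germ X](_ : _ = fun=> 1%g); last first.
  by apply/funext => y; rewrite mulgV.
move=> /(germ_unique v)/(_ (germ_one _)) /eqP.
by rewrite addrC addr_eq0 => /eqP.
Qed.

Lemma germ_translate (f : chart R n G) x : atlas f -> chart_cod f x ->
  exists L, germ (fun y => (chart_inv f x)^-1 * chart_inv f y)%g x L.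
Proof.
move=> af fx.
exists (mD (fun y => (chart_inv f x)^-1 * chart_inv f y)%g x); split=> //.
  by rewrite mulVg.
apply: (mdifferentiable_mdiff (T := fun p => (chart_inv f x)^-1 * p)%g).
  exact: mdifferentiable_chart_inv.
exact: mdiffable_lmul.
Qed.

(** T (q r) is T q times E q r, so the differential of T at q is the
    translate by T q of the differential of E q at 1.  For commutators, E is
    again a word, whose differential germM and its companions compute. *)
Lemma log_differential0_constant (T : G -> G) (E : G -> G -> G) :
  connected [set: G] ->
  (forall q r, T (q * r) = T q * E q r)%g ->
  (forall q V (F : V -> G) x L, germ F x L -> germ (E q \o F) x 0) ->
  forall p q, T p = T q.
Proof.
move=> cG TE E0; apply: zero_differential_constant => // f x af fx.
have [L gL] := germ_translate af fx.
have [E1 dE DE] := E0 (chart_inv f x) _ _ _ _ gL.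
have dl : mdiffable (fun r => T (chart_inv f x) * r)%g 1%g.
  exact: mdiffable_lmul.
rewrite -[in mdiffable _ _]E1 in dl.
have TfE : T \o chart_inv f = (fun r => T (chart_inv f x) * r)%g \o
    (E (chart_inv f x) \o (fun y => (chart_inv f x)^-1 * chart_inv f y)%g).
  by apply/funext => y /=; rewrite -TE mulVKg.
rewrite TfE; split=> [|v]; first exact: mdifferentiable_mdiff.
rewrite mD_mdiff // DE.
exact: mdiff0 dl.
Qed.

End LieGroupCalculus.

(** * The operators Ad p - 1 *)

(** The definition is locked because unification would otherwise read it as a
    sum, and the expansion of Ad1m p (u + v) would not terminate. *)
HB.lock Definition Ad1m (R : realType) (n : nat) (G : lieGroupType R n) (p : G)
  (u : 'rV[R]_n) : 'rV[R]_n := Ad p u - u.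

Section Unipotent.
Variables (R : realType) (n : nat) (G : lieGroupType R n).
Implicit Types (V : normedModType R) (p q a : G).

HB.instance Definition _ p := GRing.isLinear.Build R 'rV[R]_n 'rV[R]_n *:%R
  (Ad p) (Ad_linear p).

Lemma Ad1mE p u : Ad1m p u = Ad p u - u.
Proof. by rewrite Ad1m.unlock. Qed.

Lemma Ad1m_linear p : linear (Ad1m p).
Proof.
by move=> a u v; rewrite !Ad1mE linearP scalerBr addrACA opprD.
Qed.

HB.instance Definition _ p := GRing.isLinear.Build R 'rV[R]_n 'rV[R]_n *:%R
  (Ad1m p) (Ad1m_linear p).

Lemma Ad1mD p u v : Ad1m p (u + v) = Ad1m p u + Ad1m p v.
Proof. exact: linearD. Qed.

Lemma Ad1mN p u : Ad1m p (- u) = - Ad1m p u.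
Proof. exact: linearN. Qed.

Lemma Ad1m0 p : Ad1m p 0 = 0.
Proof. exact: linear0. Qed.

Lemma AdE p u : Ad p u = u + Ad1m p u.
Proof. by rewrite Ad1mE addrC subrK. Qed.

Lemma Ad1mM p q u :
  Ad1m (p * q)%g u = Ad1m p u + Ad1m q u + Ad1m p (Ad1m q u).
Proof.
rewrite [LHS]Ad1mE AdM !AdE linearD /=.
by apply/rowP => i; rewrite !mxE; ring.
Qed.

(** The order of the inverses differs from that of [~ p, q]: with this one,
    comm p is conjugation by p times inversion, with differential Ad p - 1. *)
Definition comm p q : G := (p * q * p^-1 * q^-1)%g.

Lemma comm1 p : comm p 1%g = 1%g.
Proof. by rewrite /comm mulg1 invg1 mulg1 mulgV. Qed.

Lemma commM p q r :
  comm p (q * r)%g = (comm p q * (q * comm p r * q^-1))%g.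
Proof. by rewrite /comm invgM !mulgA mulgVK mulgVK. Qed.

Lemma germ_eq V (F : V -> G) x L L' : (forall v, L v = L' v) ->
  germ F x L -> germ F x L'.
Proof. by move=> LL' [? ? H]; split=> // v; rewrite H. Qed.

Lemma germ_comm V (F : V -> G) x L p : germ F x L ->
  germ (fun y => comm p (F y)) x (fun v => Ad1m p (L v)).
Proof.
move=> gF; apply: germ_eq (germM (germ_conj p gF) (germV gF)) => v.
by rewrite Ad1mE.
Qed.

Lemma germ_comm_left V (F : V -> G) x L q : germ F x L ->
  germ (fun y => comm (F y) q) x (fun v => - Ad1m q (L v)).
Proof.
move=> gF; have := germM gF (germ_conj q (germV gF)).
rewrite [X in germ X](_ : _ = fun y => comm (F y) q); last first.
  by apply/funext => y; rewrite /comm !mulgA.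
move=> [? ? H]; split=> // v; rewrite H /= Ad1mE linearN.
by rewrite opprB.
Qed.

Hypothesis G_connected : connected [set: G].

(** By commM the differential of comm c at q is the one at 1 up to a
    conjugation.  It vanishes, so comm c is constant, G being connected. *)
Lemma Ad_trivial_central c : (forall u, Ad1m c u = 0) ->
  forall q, comm c q = 1%g.
Proof.
move=> c0 q; rewrite -(comm1 c).
apply: (log_differential0_constant (E := fun q r => q * comm c r * q^-1)%g)
  => // [{}q r|{}q V F x L gF]; first exact: commM.
apply: germ_eq (germ_conj q (germ_comm c gF)) => v /=.
by rewrite c0 linear0.
Qed.

(** The differential at 1 of the m-fold commutator with p. *)
Lemma Ad1m_iter0 p m : (forall x : G, iter m (comm p) x = 1%g) ->
  forall u, iter m (Ad1m p) u = 0.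
Proof.
move=> pm u; have g : germ (iter m (comm p) \o chart_inv (chart_at (1 : G)%g))
    (chart_at (1 : G)%g 1%g) (iter m (Ad1m p)).
  by elim: (m) => [|k IH] /=; [exact: germ_chart|exact: germ_comm].
rewrite (_ : _ \o _ = fun=> 1%g) in g; last by apply/funext => x /=.
exact: (germ_unique u g (germ_one _ _)).
Qed.

(** The differential at r = 1 of comm p (comm q r). *)
Lemma Ad1m_comp_of_comm p q : (forall r : G, comm p (comm q r) = 1%g) ->
  forall u, Ad1m p (Ad1m q u) = 0.
Proof.
move=> pq u; have g := germ_comm p (germ_comm q (germ_chart G)).
rewrite (_ : (fun _ => comm _ _) = fun=> 1%g) in g.
  exact: (germ_unique u g (germ_one _ _)).
by apply/funext => x /=.
Qed.

Section SquareZero.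
Hypothesis sq0 : forall p u, Ad1m p (Ad1m p u) = 0.

Lemma Ad1mV p u : Ad1m p^-1%g u = - Ad1m p u.
Proof.
have E : Ad p (u - Ad1m p u) = u by rewrite linearB /= !AdE sq0 addr0 addrK.
by rewrite [LHS]Ad1mE -{1}E -AdM mulVg Ad1 addrC addrA addNr add0r.
Qed.

(** With P = Ad1m p and Q = Ad1m q, expanding the square of
    Ad1m (p * q) = P + Q + P Q leaves
    (P Q + Q P) + P Q P + Q P Q + P Q P Q = 0.  Replacing p, q by their
    inverses changes the signs of P and Q, and the four resulting equations
    isolate P Q + Q P. *)
Lemma Ad1m_anticomm p q u : Ad1m p (Ad1m q u) = - Ad1m q (Ad1m p u).
Proof.
have E (a b : G) : Ad1m a (Ad1m b u) + Ad1m b (Ad1m a u) +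
    Ad1m a (Ad1m b (Ad1m a u)) + Ad1m b (Ad1m a (Ad1m b u)) +
    Ad1m a (Ad1m b (Ad1m a (Ad1m b u))) = 0.
  have := sq0 (a * b)%g u; rewrite !Ad1mM !(Ad1mD, sq0, Ad1m0) => <-.
  by apply/rowP => i; rewrite !mxE; ring.
have := (E p q, (E p^-1%g q, (E p q^-1%g, E p^-1%g q^-1%g))).
rewrite !(Ad1mV, Ad1mN, opprK).
move=> [/rowP E1 [/rowP E2 [/rowP E3 /rowP E4]]]; apply/rowP => i.
move: (E1 i) (E2 i) (E3 i) (E4 i); rewrite !mxE; lra.
Qed.

Lemma Ad1m_sandwich p q u : Ad1m p (Ad1m q (Ad1m p u)) = 0.
Proof. by rewrite Ad1m_anticomm sq0 Ad1m0 oppr0. Qed.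

Lemma Ad1m_comm p q u : Ad1m (comm p q) u = 2 *: Ad1m p (Ad1m q u).
Proof.
rewrite /comm !Ad1mM !Ad1mV !(Ad1mD, Ad1mN) (Ad1m_anticomm q p).
rewrite !(Ad1mD, Ad1mN, sq0, Ad1m_sandwich, Ad1m0).
apply/rowP => i; rewrite !mxE; ring.
Qed.

(** By commM the map q |-> comm p (comm p q) has at q the differential
    P (Ad q) P up to a conjugation, with P = Ad1m p and Q = Ad1m q, and this is
    P P + P Q P = 0. *)
Lemma two_engel p q : comm p (comm p q) = 1%g.
Proof.
rewrite -[RHS](comm1 p) -[in RHS](comm1 p).
apply: (log_differential0_constant (T := fun q => comm p (comm p q))
  (E := fun q r => comm p q * comm p (q * comm p r * q^-1) * (comm p q)^-1)%g)
  => // [{}q r|{}q V F x L gF]; first by rewrite commM commM.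
apply: germ_eq
  (germ_conj _ (germ_comm p (germ_conj q (germ_comm p gF)))) => v /=.
by rewrite /= (AdE q) Ad1mD sq0 Ad1m_sandwich addr0 linear0.
Qed.

Lemma comm_mull p q r : comm (p * r)%g q = (p * comm r q * p^-1 * comm p q)%g.
Proof. by rewrite /comm invgM !mulgA mulgVK mulgVK. Qed.

(** The left-hand side is a product of conjugates of r, e and their inverses,
    the form in which germM applies. *)
Lemma comm_factor p c r e : (p * c = c * p)%g ->
  (p * r * p^-1 * (p * e * p^-1) * (c * (p * r^-1 * p^-1) * c^-1) * e^-1)%g =
  comm (p * r)%g (e * c)%g.
Proof.
move=> pc; rewrite /comm !invgM !mulgA !mulgVK.
by rewrite -(mulgA _ c p) -pc !mulgA mulgVK.
Qed.

(** The word comm (p r) (comm (p r) q) is trivial by two_engel.  Its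
    differential at r = 1, computed from the factorisation comm_factor, is
    minus 3 P Q u, with P = Ad1m p and Q = Ad1m q, once P P = 0, P Q = - Q P
    and Ad1m (comm p q) = 2 P Q are used. *)
Lemma Ad1m_comp_eq0 p q u : Ad1m p (Ad1m q u) = 0.
Proof.
pose c := comm p q.
have pc : (p * c = c * p)%g.
  have := two_engel p q; rewrite /comm -/(comm p q) -/c.
  by move=> /(congr1 (fun x => x * c * p)%g); rewrite !mulgVK mul1g.
pose F := chart_inv (chart_at (1 : G)%g).
pose e y := (p * comm (F y) q * p^-1)%g.
have ge := germ_conj p (germ_comm_left q (germ_chart G)).
have g := germM (germM (germM (germ_conj p (germ_chart G)) (germ_conj p ge))
  (germ_conj c (germ_conj p (germV (germ_chart G))))) (germV ge).
rewrite [X in germ X](_ : _ = fun=> 1%g) in g; last first.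
  apply/funext => y; rewrite (comm_factor _ _ pc) /c -comm_mull.
  exact: two_engel.
have /= := germ_unique u g (germ_one _ _).
rewrite !(AdE, Ad1mN, Ad1mD, Ad1m_comm, sq0, Ad1m_sandwich, Ad1m0).
move=> /rowP E; apply/rowP => i; move: (E i); rewrite !mxE; lra.
Qed.

Lemma comm_central p q r : comm (comm p q) r = 1%g.
Proof.
apply: Ad_trivial_central => u; by rewrite Ad1m_comm Ad1m_comp_eq0 scaler0.
Qed.

End SquareZero.

End Unipotent.

(** * Lengths of curves *)

Section IncrementBound.
Variable R : realType.
Notation mu := lebesgue_measure.

(** By the fundamental theorem of calculus, the function
    C * (integral of s up to x) - h x has nonnegative derivative. *)
Lemma increment_le_integral (h dh s : R -> R) (C : R) :
  (forall t : R, 0 <= t <= 1 -> is_derive t 1 h (dh t)) ->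
  (forall t : R, 0 <= t <= 1 -> {for t, continuous s}) ->
  (forall t : R, 0 <= t <= 1 -> dh t <= C * s t) ->
  h 1 - h 0 <= C * (\int[mu]_(t in `[0%R, 1%R]) s t)%R.
Proof.
move=> dhE cs dhs; pose S x := (\int[mu]_(t in `[0%R, x]) s t)%R.
have csw : {within `[0, 1], continuous s}.
  apply: continuous_in_subspaceT => t; rewrite inE /= in_itv /= => t01.
  exact: cs.
have is01 : mu.-integrable `[0%R, 1%R] (EFin \o s).
  by apply: continuous_compact_integrable => //; exact: segment_compact.
have dS (t : R) : 0 < t < 1 -> is_derive t 1 S (s t).
  move=> /andP[t0 t1].
  have t01 : 0 <= t <= 1 by rewrite !ltW.
  have [d1 d2] := continuous_FTC1_closed t1 is01 t0 (cs t t01).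
  by apply: DeriveDef => //; rewrite -derive1E.
have cS : {within `[0, 1], continuous S}.
  exact: parameterized_integral_continuous.
pose k x := C * S x - h x.
have ch : {within `[0, 1], continuous h}.
  apply: continuous_in_subspaceT => t; rewrite inE /= in_itv /= => t01.
  have [dt _] := dhE t t01.
  by apply: differentiable_continuous; exact/derivable1_diffP.
have [||c] := @MVT R k (fun x => C * s x - dh x) 0 1 ltr01.
- move=> t; rewrite in_itv /= => t01.
  have dSt := dS t t01.
  have dht : is_derive t 1 h (dh t).
    by apply: dhE; case/andP: t01 => /ltW -> /ltW ->.
  exact: is_deriveB.
- move=> x; apply: cvgB; last exact: ch.
  by apply: cvgMr; exact: cS.
rewrite in_itv /= subr0 mulr1 => /andP[c0 c1] E.
have := dhs c (ltac:(by rewrite !ltW)).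
rewrite -subr_ge0 -E /k /S set_itv1 Rintegral_set1 mulr0 => H; lra.
Qed.

Lemma norm_increment_le_integral (h dh s : R -> R) (C : R) :
  (forall t : R, 0 <= t <= 1 -> is_derive t 1 h (dh t)) ->
  (forall t : R, 0 <= t <= 1 -> {for t, continuous s}) ->
  (forall t : R, 0 <= t <= 1 -> `|dh t| <= C * s t) ->
  `|h 1 - h 0| <= C * (\int[mu]_(t in `[0%R, 1%R]) s t)%R.
Proof.
move=> dhE cs dhs; rewrite ler_norml; apply/andP; split; last first.
  apply: (@increment_le_integral h dh) => // t t01.
  exact: le_trans (ler_norm _) (dhs t t01).
rewrite lerNl.
have := @increment_le_integral (fun t => - h t) (fun t => - dh t) s C.
rewrite opprB opprK addrC; apply => // t t01.
  by have := dhE t t01 => ?; exact: is_deriveN.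
by apply: le_trans (dhs t t01); rewrite -normrN ler_norm.
Qed.

End IncrementBound.

Lemma scalar_productZZ (R : realType) n (s : scalar_product R n) a b u v :
  s (a *: u) (b *: v) = a * (b * s u v).
Proof.
transitivity (a * s u (b *: v)); first exact: linearZl_LR.
congr (_ * _); exact: linearZr_LR.
Qed.

Section Paths.
Variables (R : realType) (n : nat) (M : manifoldType R n).
Implicit Types (g : riemannian_metric M) (c : R -> M) (p q : M).

Lemma velocityE c t : velocity c t = mD (c : R^o -> M) t 1.
Proof. by rewrite /velocity derive1E. Qed.

Lemma arc_length_ge0 g c : 0 <= arc_length g c.
Proof. by apply: Rintegral_ge0 => t _; exact: sqrtr_ge0. Qed.

Definition path_length g (s : seq (R -> M)) := \sum_(c <- s) arc_length g c.

Lemma path_length_ge0 g s : 0 <= path_length g s.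
Proof. by apply: sumr_ge0 => c _; exact: arc_length_ge0. Qed.

Lemma C1_path_cat p q r s s' :
  C1_path p q s -> C1_path q r s' -> C1_path p r (s ++ s').
Proof.
elim: s p => [|c s IH] p /=; first by move=> ->.
by move=> [cc c0 cs] qr; split=> //; exact: IH.
Qed.

Lemma riemannian_dist_le g p q s : C1_path p q s ->
  riemannian_dist g p q <= path_length g s.
Proof.
move=> pqs; apply: ge_inf; last by exists s.
by exists 0 => _ [s' _ <-]; exact: path_length_ge0.
Qed.

(** Without a path from p to q the infimum would be that of the empty set,
    which is 0 by convention. *)
Lemma le_riemannian_dist g p q (C : R) : (exists s, C1_path p q s) ->
  (forall s, C1_path p q s -> C <= path_length g s) ->
  C <= riemannian_dist g p q.
Proof.
move=> [s pqs] H; apply: lb_le_inf; first by exists (path_length g s), s.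
by move=> _ [s' pqs' <-]; exact: H.
Qed.

Lemma Ck_on_line k (V : normedModType R) (x v : V) (A : set R^o) : open A ->
  Ck_on k (fun t : R^o => x + t *: v) A.
Proof.
move=> oA; apply: Ck_onD => //; first exact: Ck_on_cst.
apply: (Ck_on_scale (a := idfun)) => //; last exact: Ck_on_cst.
by apply: Ck_on_linear => // t; exact: cvg_id.
Qed.

Lemma segment_path (f : chart R n M) x y : atlas f ->
  (forall t : R, 0 <= t <= 1 -> chart_cod f (x + t *: (y - x))) ->
  C1_path (chart_inv f x) (chart_inv f y)
    [:: fun t => chart_inv f (x + t *: (y - x))].
Proof.
move=> af xy; split; last 2 first.
- by rewrite scale0r addr0.
- by rewrite /= scale1r subrKC.
pose s (t : R^o) := x + t *: (y - x).
have cs (t : R^o) : {for t, continuous s}.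
  exact: (Ck_on_line 0 x (y - x) openT).
pose U := [set: R^o] `&` s @^-1` chart_cod f.
have oU : open U.
  by apply: open_setI_preimage; [exact: openT| |exact: chart_cod_open].
exists U.
  split=> // t; rewrite /= in_itv /= => t01; split=> //; exact: xy.
apply: (@Ck_into_comp R _ _ n M 1 (chart_inv f) s U (chart_cod f)) => //.
- exact: has_coordinates_rV.
- by move=> t [].
- by move=> j _; exact: Ck_on_line.
- exact: Ck_into_chart_inv.
Qed.

(** Being joined to p by a path is a locally constant property of the endpoint,
    because nearby points are joined by segments in a chart. *)
Lemma connected_C1_path : connected [set: M] ->
  forall p q, exists s, C1_path p q s.
Proof.
move=> cM p q.
suff -> : (exists s, C1_path p q s) = (exists s, C1_path p p s) by exists [::].
apply: (connected_locally_constant (f := fun q => exists s, C1_path p q s)) =>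
  // {}q.
pose f := chart_at q.
have af : atlas f by exact: chart_at_atlas.
have fq : chart_cod f (f q) by apply: chart_fun_cod; exact: chart_at_dom.
have [r /= r0 rP] := (nbhs_ballP (f q) _).1
  (open_nbhs_nbhs (conj (@chart_cod_open _ _ _ f) fq)).
have cf : {for q, continuous f}.
  by apply: chart_fun_continuous; exact: chart_at_dom.
have nearB : \forall z \near q, ball (f q) r (f z).
  by apply: cf; exact: nbhsx_ballx.
have nearD : \forall z \near q, chart_dom f z.
  by apply: open_nbhs_nbhs; split; [exact: chart_dom_open|exact: chart_at_dom].
apply: filterS2 nearB nearD => z Bz Dz.
have seg (t : R) : 0 <= t <= 1 -> ball (f q) r (f q + t *: (f z - f q)).
  move=> /andP[t0 t1]; move: Bz; rewrite -!ball_normE /=.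
  rewrite opprD addrA subrr sub0r normrN normrZ ger0_norm // distrC.
  by apply: le_lt_trans; rewrite ler_piMl.
have qz : C1_path q z [:: fun t => chart_inv f (f q + t *: (f z - f q))].
  rewrite -[X in C1_path X](chart_funK (chart_at_dom q)).
  rewrite -[in X in C1_path _ X](chart_funK Dz).
  by apply: segment_path => // t t01; apply: rP; exact: seg.
have zq : C1_path z q [:: fun t => chart_inv f (f z + t *: (f q - f z))].
  rewrite -[X in C1_path X](chart_funK Dz).
  rewrite -[in X in C1_path _ X](chart_funK (chart_at_dom q)).
  apply: segment_path => // t /andP[t0 t1]; apply: rP.
  have -> : f z + t *: (f q - f z) = f q + (1 - t) *: (f z - f q).
    by apply/rowP => i; rewrite !mxE; ring.
  by apply: seg; rewrite subr_ge0 t1 /= lerBlDr lerDl.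
apply/propext; split=> -[s ps].
  by exists (s ++ [:: fun t => chart_inv f (f z + t *: (f q - f z))]);
    exact: C1_path_cat ps zq.
by exists (s ++ [:: fun t => chart_inv f (f q + t *: (f z - f q))]);
  exact: C1_path_cat ps qz.
Qed.

Lemma C1_arc_mdifferentiable c (t : R) : C1_arc c -> 0 <= t <= 1 ->
  mdifferentiable (c : R^o -> M) t.
Proof.
move=> [U [oU U01] [cc dc]] t01.
apply: (@Ck_into_mdifferentiable R R^o n M 0 c U) => //.
by apply: U01; rewrite /= in_itv.
Qed.

Lemma coord_vector_sum (f : chart R n M) x (a : 'rV[R]_n) : atlas f ->
  chart_cod f x -> coord_vector f x a =
  \sum_i a 0 i *: coord_vector f x (delta_mx 0 i).
Proof.
move=> af fx.
have [_ d] := mdifferentiable_chart_inv af fx.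
rewrite /coord_vector deriveE // {1}(row_sum_delta a) linear_sum.
by apply: eq_bigr => i _; rewrite linearZ /= deriveE.
Qed.

(** The preferred chart at c t jumps as t varies, so velocity c is in general
    not continuous.  In a fixed chart, though, the squared speed is a quadratic
    form with continuous coefficients in the continuous derivative of c. *)
Lemma speed_continuous g c (t : R) : C1_arc c -> 0 <= t <= 1 ->
  {for t, continuous (fun t => sp_norm (g (c t)) (velocity c t))}.
Proof.
move=> [U [oU U01] [cc dc]] t01.
have Ut : U t by apply: U01; rewrite /= in_itv.
pose f := chart_at (c t).
have af : atlas f by exact: chart_at_atlas.
pose x (u : R^o) := f (c u).
pose G i j (y : 'rV[R]_n) := g (chart_inv f y)
  (coord_vector f y (delta_mx 0 i)) (coord_vector f y (delta_mx 0 j)).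
pose A := U `&` (c : R^o -> M) @^-1` chart_dom f.
have oA : open A.
  by apply: open_setI_preimage => //; exact: chart_dom_open.
have At : A t by split => //; exact: chart_at_dom.
have [dx cx'] := dc f af.
pose a (u : R^o) : 'rV[R]_n := 'D_1 x u.
have E u : A u -> \sum_i \sum_j a u 0 i * (a u 0 j * G i j (x u)) =
    g (c u) (velocity c u) (velocity c u).
  move=> Au; have [Uu fu] := Au.
  have xu : chart_cod f (x u) by exact: chart_fun_cod.
  have cE : c u = chart_inv f (x u) by rewrite /x chart_funK.
  have vE : velocity c u = coord_vector f (x u) (a u).
    have K : mD (chart_inv f \o x) u (1 : R^o) = coord_vector f (x u) (a u).
      exact: mD_comp (dx u Au) (mdifferentiable_chart_inv af xu).
    rewrite velocityE -K.
    apply: near_eq_mD; apply: filterS (open_nbhs_nbhs (conj oA Au)) => w [_ fw].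
    by rewrite /= chart_funK.
  rewrite cE vE coord_vector_sum // linear_sumlz; apply: eq_bigr => i _.
  rewrite linear_sumr; apply: eq_bigr => j _.
  by symmetry; exact: scalar_productZZ.
rewrite /sp_norm.
have cS : {for t, continuous (fun u : R^o =>
    Num.sqrt (\sum_i \sum_j a u 0 i * (a u 0 j * G i j (x u))))}.
  apply: continuous_comp; last exact: sqrt_continuous.
  have ca i : {for t, continuous (fun u => a u 0 i)}.
    exact: (@continuous_comp _ _ _ a (fun v : 'rV[R]_n => v 0 i) t (cx' 1 t At)
      (@coord_continuous R 1 n 0 i _)).
  apply: cvg_big => [|i _]; first exact: add_continuous.
  apply: cvg_big => [|j _]; first exact: add_continuous.
  apply: cvgM; first exact: ca.
  apply: cvgM; first exact: ca.
  have cx : {for t, continuous x}.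
    by apply: differentiable_continuous; exact: dx.
  apply: (@continuous_comp _ _ _ x (G i j) t cx).
  apply: (metric_smooth g (delta_mx 0 i) (delta_mx 0 j) af 0%N).
  by apply: chart_fun_cod; exact: chart_at_dom.
rewrite /prop_for /continuous_at -(E t At).
apply: cvg_trans cS; apply: near_eq_cvg.
by apply: filterS (open_nbhs_nbhs (conj oA At)) => u Au; rewrite /= E.
Qed.

End Paths.

(** * Left-invariant lengths, and growth along the powers of an element *)

Section ScalarProduct.
Variables (R : realType) (n : nat) (s : scalar_product R n).
Implicit Types u v w : 'rV[R]_n.

Lemma scalar_product_ge0 u : 0 <= s u u.
Proof.
have [->|u0] := eqVneq u 0; first by rewrite linear0l.
by apply: ltW; exact: neq0_dnorm_gt0.
Qed.

Lemma scalar_productC u v : s u v = s v u.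
Proof. by rewrite hermC expr0 mul1r. Qed.

Lemma scalar_productDl u v w : s (u + v) w = s u w + s v w.
Proof. exact: linearDl. Qed.

Lemma scalar_productZl a u w : s (a *: u) w = a * s u w.
Proof. exact: linearZl_LR. Qed.

Lemma scalar_productDr u v w : s w (u + v) = s w u + s w v.
Proof. exact: linearDr. Qed.

Lemma scalar_productZr a u w : s w (a *: u) = a * s w u.
Proof. exact: linearZr_LR. Qed.

Lemma cauchy_schwarz u v : s u v <= sp_norm s u * sp_norm s v.
Proof.
have [->|v0] := eqVneq v 0.
  by rewrite linear0r mulr_ge0 // sqrtr_ge0.
have vv : 0 < s v v by exact: neq0_dnorm_gt0.
have H : s u v ^+ 2 <= s u u * s v v.
  have := scalar_product_ge0 (s v v *: u + (- s u v) *: v).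
  rewrite !(scalar_productDl, scalar_productDr, scalar_productZl,
    scalar_productZr) (scalar_productC v u) => H.
  have : 0 <= s v v * (s u u * s v v - s u v ^+ 2) by nra.
  by rewrite pmulr_rge0 // subr_ge0.
rewrite /sp_norm -sqrtrM ?scalar_product_ge0 //.
apply: le_trans (ler_norm _) _; rewrite -sqrtr_sqr; exact: ler_wsqrtr.
Qed.

End ScalarProduct.

Section LeftInvariantPaths.
Variables (R : realType) (n : nat) (G : lieGroupType R n).
Variable g : riemannian_metric G.
Hypothesis g_inv : left_invariant g.
Implicit Types (c : R -> G) (p q a : G).

Lemma C1_arc_translate a c : C1_arc c -> C1_arc (fun t => a * c t)%g.
Proof.
move=> [U [oU U01] dc]; exists U => //.
apply: (@Ck_into_mul R n G R^o 1 (fun=> a) c U oU _ dc).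
exact: Ck_into_cst.
Qed.

Lemma velocity_translate a c t : C1_arc c -> 0 <= t <= 1 ->
  velocity (fun t => a * c t)%g t =
  mdiff (fun x => a * x)%g (c t) (velocity c t).
Proof.
move=> cc t01; rewrite !velocityE.
exact: (@mD_mdiff R R^o n n G G (fun x => a * x)%g c t
  (C1_arc_mdifferentiable cc t01) (mdiffable_lmul a (c t))).
Qed.

Lemma arc_length_translate a c : C1_arc c ->
  arc_length g (fun t => a * c t)%g = arc_length g c.
Proof.
move=> cc; apply: eq_Rintegral => t; rewrite inE /= in_itv /= => t01.
rewrite (velocity_translate a cc t01) /sp_norm; congr Num.sqrt.
exact: g_inv.
Qed.

Lemma C1_path_translate a p q s : C1_path p q s ->
  C1_path (a * p)%g (a * q)%g [seq (fun t => a * c t)%g | c : R -> G <- s].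
Proof.
elim: s p => [|c s IH] p /=; first by move=> ->.
by move=> [cc <- ps]; split=> //; [exact: C1_arc_translate|exact: IH].
Qed.

Lemma path_length_translate a p q s : C1_path p q s ->
  path_length g [seq (fun t => a * c t)%g | c : R -> G <- s] = path_length g s.
Proof.
elim: s p => [|c s IH] p; first by [].
move=> [cc _ ps]; rewrite /path_length map_cons.
rewrite [LHS]big_cons [RHS]big_cons (arc_length_translate a cc).
by congr (_ + _); exact: IH ps.
Qed.

(** Concatenate the translates of s by 1, p, ..., p^(k-1). *)
Lemma C1_path_expg p s k : C1_path 1%g p s ->
  exists2 s', C1_path 1%g (p ^+ k)%g s' &
    path_length g s' = k%:R * path_length g s.
Proof.
move=> ps; elim: k => [|k [s' ps' ls']].
  by exists [::] => //; rewrite /path_length big_nil mul0r.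
exists (s ++ [seq (fun t => p * c t)%g | c : R -> G <- s']).
  apply: (C1_path_cat ps); rewrite expgS.
  by rewrite -[X in C1_path X](mulg1 p); exact: C1_path_translate.
rewrite /path_length big_cat /= -/(path_length g s).
have := path_length_translate p ps'; rewrite {1}/path_length => ->.
by rewrite ls' -[in RHS]natr1 mulrDl mul1r addrC.
Qed.

(** The derivative of mu \o c at t is that of u |-> mu (c t ^-1 * c u) at t,
    i.e. the linear form 'd mu1 e at the velocity translated back to 1, whose
    norm is the speed of c by left invariance. *)
Lemma hom_arc_bound (mu : G -> R) (C : R) c :
  (forall p q, mu (p * q)%g = mu p + mu q) ->
  let mu1 := (mu : G -> R^o) \o chart_inv (chart_at (1 : G)%g) in
  let e := chart_at (1 : G)%g 1%g in
  differentiable mu1 e ->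
  (forall w, `|'d mu1 e w : R| <= C * sp_norm (g 1%g) w) ->
  C1_arc c -> `|mu (c 1) - mu (c 0)| <= C * arc_length g c.
Proof.
move=> muM mu1 e dmu muC cc.
pose F t (u : R^o) := ((c t)^-1 * c u)%g.
have F1 t : F t t = 1%g by rewrite /F mulVg.
have dF t : 0 <= t <= 1 -> mdifferentiable (F t) t.
  move=> t01; apply: (C1_arc_mdifferentiable _ t01).
  exact: C1_arc_translate.
pose w t := mD (F t) t (1 : R^o).
apply: (@norm_increment_le_integral R (fun t => mu (c t))
  (fun t => 'd mu1 e (w t) : R)) => t t01; last first.
- apply: (le_trans (muC _)).
  have wE : w t = mdiff (fun x => (c t)^-1 * x)%g (c t) (velocity c t).
    rewrite -(velocity_translate (c t)^-1%g cc t01) velocityE.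
    by [].
  by rewrite wE /sp_norm -(g_inv (c t)^-1%g (c t)) mulVg.
- exact: speed_continuous.
have [cF] := dF t t01; rewrite F1 => dcF.
have eE : (chart_at (1 : G)%g \o F t) t = e by rewrite /= F1.
have E : \forall u \near t,
    (cst (mu (c t)) \+ (mu1 \o (chart_at (1 : G)%g \o F t))) u
    = mu (c u) :> R^o.
  have nF : \forall u \near t, chart_dom (chart_at (1 : G)%g) (F t u).
    by apply: continuous_near_dom => //; rewrite F1; exact: chart_at_dom.
  apply: filterS nF => u Fu.
  by rewrite /mu1 /= chart_funK // /F -muM mulVKg.
apply: (@near_eq_is_derive R R^o R^o _ _ t 1 _ E).
have dmuF : differentiable mu1 ((chart_at (1 : G)%g \o F t) t) by rewrite eE.
have d1 := differentiable_comp dcF dmuF.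
have dcst : differentiable (cst (mu (c t)) : R^o -> R^o) t.
  exact: differentiable_cst.
have D1 := derive_comp (1 : R^o) dcF dmuF.
apply: DeriveDef; first by apply: diff_derivable; exact: differentiableD.
rewrite deriveD; [|exact: derivable_cst|exact: diff_derivable].
rewrite derive_cst add0r D1 eE /w /mD F1.
exact: erefl.
Qed.

Lemma hom_path_bound (mu : G -> R) (C : R) p q s :
  (forall p q, mu (p * q)%g = mu p + mu q) ->
  let mu1 := (mu : G -> R^o) \o chart_inv (chart_at (1 : G)%g) in
  let e := chart_at (1 : G)%g 1%g in
  differentiable mu1 e ->
  (forall w, `|'d mu1 e w : R| <= C * sp_norm (g 1%g) w) ->
  C1_path p q s -> `|mu q - mu p| <= C * path_length g s.
Proof.
move=> muM mu1 e dmu muC; elim: s p => [|c s IH] p /=.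
  by move=> ->; rewrite subrr normr0 /path_length big_nil mulr0.
move=> [cc <- ps]; rewrite /path_length big_cons mulrDr.
have -> : mu q - mu (c 0) = (mu (c 1) - mu (c 0)) + (mu q - mu (c 1)).
  by ring.
apply: le_trans (ler_normD _ _) _; apply: lerD.
  exact: (hom_arc_bound muM dmu muC cc).
exact: IH ps.
Qed.

End LeftInvariantPaths.

Section GrowthNecessary.
Variables (R : realType) (n : nat) (G : lieGroupType R n).
Implicit Types (p : G).

(** The binomial expansion of (1 + N)^k, cut off by N^3 v = 0. *)
Lemma Ad_expg_quadratic p v k :
  Ad1m p (Ad1m p (Ad1m p v)) = 0 ->
  Ad (p ^+ k)%g v =
    v + k%:R *: Ad1m p v + ('C(k, 2))%:R *: Ad1m p (Ad1m p v).
Proof.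
move=> v3; elim: k => [|k IH]; first by rewrite Ad1 bin0n !scale0r !addr0.
rewrite expgS AdM IH AdE !Ad1mD.
have Z a u : Ad1m p (a *: u) = a *: Ad1m p u by exact: linearZ.
rewrite !Z v3 scaler0 addr0 binS bin1 natrD -[in RHS]natr1 !scalerDl scale1r.
by apply/rowP => i; rewrite !mxE; ring.
Qed.

Lemma quadratic_not_linear (al be ga A B : R) : 0 < ga ->
  (forall k : nat, al + k%:R * be + ('C(k, 2))%:R * ga <= A + k%:R * B) ->
  False.
Proof.
move=> ga0 H; pose D := `|A - al| + `|B - be|.
have D0 : 0 <= D by rewrite addr_ge0.
have Dga : 0 <= 2 * D / ga by rewrite divr_ge0 ?(ltW ga0) // mulr_ge0.
have [k kD] : exists k : nat, 2 * D / ga + 2 < k%:R.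
  by exists (Num.bound (2 * D / ga + 2)); apply: archi_boundP; rewrite addr_ge0.
have k1 : 1 <= k%:R :> R by lra.
have C2 : ('C(k, 2))%:R = k%:R * (k%:R - 1) / 2 :> R.
  have k0 : (0 < k)%N by rewrite -(ler1n R).
  have /(congr1 (fun i => i%:R : R)) := mul_bin_diag k 1.
  by rewrite bin1 !natrM -subn1 natrB // => ->; field.
move: (H k); rewrite C2 => Hk.
have e1 : A - al <= `|A - al| * k%:R.
  by apply: le_trans (ler_norm _) _; rewrite ler_peMr.
have e2 : k%:R * (B - be) <= k%:R * `|B - be|.
  by rewrite ler_wpM2l ?ler0n // ler_norm.
have : k%:R * ((k%:R - 1) * ga / 2) <= k%:R * D by rewrite /D; nra.
rewrite ler_pM2l; last by apply: lt_le_trans k1; rewrite ltr01.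
move: kD; rewrite -ltrBrDr ltr_pdivrMr // => kD' E.
nra.
Qed.

(** Take v such that (Ad p - 1)^2 v <> 0 but (Ad p - 1)^3 v = 0.  Pairing
    Ad (p ^+ k) v with z = (Ad p - 1)^2 v gives a quadratic polynomial in k
    with leading coefficient e z z / 2, while r (p ^+ k) grows at most
    linearly. *)
Lemma linear_growth_square_zero m : connected [set: G] ->
  (forall p x, iter m (comm p) x = 1%g) -> linear_growth G ->
  forall p u, Ad1m p (Ad1m p u) = 0.
Proof.
move=> cG nilG [g [e [a [b [g_inv gr]]]]] p u.
apply: contrapT => /eqP u2.
have ex : exists j, iter j (Ad1m p) (Ad1m p (Ad1m p u)) == 0.
  exists m; apply/eqP; exact: Ad1m_iter0.
case: (ex_minnP ex) => -[|j] /eqP j0 jmin.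
  by rewrite [Ad1m _ _]j0 eqxx in u2.
pose v := iter j (Ad1m p) u.
have comm_iter i w : iter i (Ad1m p) (Ad1m p w) = Ad1m p (iter i (Ad1m p) w).
  by rewrite -iterSr.
have v2 : Ad1m p (Ad1m p v) != 0.
  apply/eqP => v20; suff /jmin : iter j (Ad1m p) (Ad1m p (Ad1m p u)) == 0.
    by rewrite ltnn.
  by rewrite !comm_iter -/v v20.
have v3 : Ad1m p (Ad1m p (Ad1m p v)) = 0.
  by rewrite -j0 iterS !comm_iter.
pose z := Ad1m p (Ad1m p v).
have [s ps] := connected_C1_path cG 1%g p.
pose L := path_length g s.
apply: (@quadratic_not_linear (e v z) (e (Ad1m p v) z) (e z z)
  (a * sp_norm e v * sp_norm e z) (`|b| * L * sp_norm e v * sp_norm e z)).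
  exact: neq0_dnorm_gt0.
move=> k; have [s' ps' ls'] := C1_path_expg g_inv k ps.
have [k0 /(_ v)/andP[_ up]] := gr (p ^+ k)%g.
have rk : riemannian_dist g 1%g (p ^+ k)%g <= k%:R * L.
  by rewrite -ls'; exact: riemannian_dist_le.
have r0 : 0 <= riemannian_dist g 1%g (p ^+ k)%g.
  apply: le_riemannian_dist; first by exists s'.
  by move=> ? _; exact: path_length_ge0.
have -> : e v z + k%:R * e (Ad1m p v) z + ('C(k, 2))%:R * e z z =
    e (Ad (p ^+ k)%g v) z.
  by rewrite (Ad_expg_quadratic _ v3) !scalar_productDl !scalar_productZl.
apply: le_trans (cauchy_schwarz _ _ _) _.
have vz : 0 <= sp_norm e v * sp_norm e z by rewrite mulr_ge0 ?sqrtr_ge0.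
apply: le_trans (ler_wpM2r (sqrtr_ge0 _) up) _.
have br : b * riemannian_dist g 1%g (p ^+ k)%g <= `|b| * (k%:R * L).
  apply: le_trans (ler_norm _) _; rewrite normrM (ger0_norm r0).
  exact: ler_wpM2l.
rewrite [leRHS](_ : _ =
  (a + `|b| * (k%:R * L)) * (sp_norm e v * sp_norm e z)); last by ring.
rewrite -/(sp_norm e z) -mulrA.
by apply: ler_wpM2r => //; rewrite lerD2l.
Qed.

End GrowthNecessary.

(** * The left-invariant metric extending the standard scalar product *)

Section PartialDerivatives.
Variables (R : realType) (n : nat) (G : lieGroupType R n).
Local Notation rV := 'rV[R]_n.

(** The two difference quotients are equal. *)
Lemma derive_snd (U V W : normedModType R) (H : U * V -> W) x y v :
  'D_(0, v) H (x, y) = 'D_v (fun z => H (x, z)) y.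
Proof.
have E : (fun h : R => h^-1 *: ((H \o shift (x, y)) (h *: (0, v)) - H (x, y))) =
    (fun h : R => h^-1 *: (((fun z => H (x, z)) \o shift y) (h *: v) - H (x, y))).
  apply/funext => h /=; congr (_ *: (H _ - _)).
  by rewrite /GRing.scale /= /GRing.add /= /add_pair /= scaler0 add0r.
by rewrite /derive E.
Qed.

Lemma smooth_partial k (F : rV * rV -> G) (A : set (rV * rV))
    (f : chart R n G) (v : rV) : Ck_into k.+1 F A -> atlas f ->
  Ck_on k (fun z => 'D_(0, v) (f \o F) z) (A `&` F @^-1` chart_dom f).
Proof. by move=> [_ dF] af; have [_] := dF f af; apply. Qed.

(** Ad is the partial derivative in the second variable, at the unit, of the
    conjugation map, which is smooth in both variables. *)
Lemma Ad_differentiable (u : rV) :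
  differentiable (fun x => Ad (chart_inv (chart_at (1 : G)%g) x) u)
    (chart_at (1 : G)%g 1%g).
Proof.
set c := chart_at (1 : G)%g; set e := c 1%g.
have ac : atlas c by exact: chart_at_atlas.
have ce : chart_cod c e by apply: chart_fun_cod; exact: chart_at_dom.
have inve : chart_inv c e = 1%g by rewrite chart_funK //; exact: chart_at_dom.
have oA : open (chart_cod c `*` chart_cod c).
  by apply: open_setX; exact: chart_cod_open.
pose K (z : rV * rV) :=
  (chart_inv c z.1 * chart_inv c z.2 * (chart_inv c z.1)^-1)%g.
have sK : Ck_into 2 K (chart_cod c `*` chart_cod c).
  apply: Ck_into_mul => //.
    by apply: Ck_into_mul => //; [exact: Ck_into_fst|exact: Ck_into_snd].
  by apply: Ck_into_inv => //; exact: Ck_into_fst.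
have [dK _] := smooth_partial u sK ac.
have K1 x : K (x, e) = 1%g by rewrite /K /= inve mulg1 mulgV.
have Be : ((chart_cod c `*` chart_cod c) `&` K @^-1` chart_dom c) (e, e).
  by split=> //; rewrite /= K1; exact: chart_at_dom.
have d1 : differentiable (fun x : rV => (x, e)) e by exact: differentiable_pair.
have dd := differentiable_comp d1 (dK _ Be).
apply: near_eq_differentiable dd.
near=> x; rewrite /= derive_snd /Ad /mdiff mulg1 mulgV.
by [].
Unshelve. all: by end_near. Qed.

End PartialDerivatives.

(** The left translation to the tangent space at 1, locked because unification
    would otherwise unfold the underlying limit when it meets a matrix entry. *)
HB.lock Definition to_identity (R : realType) (n : nat) (G : lieGroupType R n)
  (p : G) (u : 'rV[R]_n) : 'rV[R]_n := mdiff (fun x : G => p^-1 * x)%g p u.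

Section LeftMetric.
Variables (R : realType) (n : nat) (G : lieGroupType R n).
Local Notation rV := 'rV[R]_n.
Implicit Types (p q : G).

Lemma to_identityE p u :
  to_identity p u = mdiff (fun x : G => p^-1 * x)%g p u.
Proof. by rewrite to_identity.unlock. Qed.

Lemma to_identity_linear p : linear (to_identity p).
Proof.
move=> a u v; rewrite !to_identityE.
by apply: mdiff_linear; exact: mdiffable_lmul.
Qed.

(** Translating back by p is a left inverse. *)
Lemma to_identity_inj p u : to_identity p u = 0 -> u = 0.
Proof.
move=> u0.
have := mdiff_comp (T := (fun x : G => p * x)%g) u (mdiffable_lmul p^-1%g p)
  (mdiffable_lmul p _).
rewrite -to_identityE u0 mdiff0; last exact: mdiffable_lmul.
rewrite (_ : _ \o _ = fun x => x) ?mdiff_id //.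
by apply/funext => x /=; rewrite mulVKg.
Qed.

Lemma to_identity1 u : to_identity (1 : G)%g u = u.
Proof.
rewrite to_identityE (_ : (fun _ => _) = fun x : G => x) ?mdiff_id //.
by apply/funext => x /=; rewrite invg1 mul1g.
Qed.

Lemma to_identity_translate p q u :
  to_identity (p * q)%g (mdiff (fun x : G => p * x)%g q u) = to_identity q u.
Proof.
have E : (fun x : G => (p * q)^-1 * x)%g \o (fun x : G => p * x)%g =
    (fun x : G => q^-1 * x)%g.
  by apply/funext => x /=; rewrite invgM -mulgA mulKg.
rewrite !to_identityE -E; symmetry.
by apply: mdiff_comp; exact: mdiffable_lmul.
Qed.

Definition left_form p (u v : rV) : R :=
  \sum_i to_identity p u 0 i * to_identity p v 0 i.

Lemma left_form_bilinear p : bilinear_for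
  (GRing.Scale.Law.clone _ _ *%R _) (GRing.Scale.Law.clone _ _ *%R _)
  (left_form p).
Proof.
split=> w a u v; rewrite /= /left_form to_identity_linear mulr_sumr;
  rewrite -big_split /=;
  by apply: eq_bigr => i _; rewrite !mxE; ring.
Qed.

HB.instance Definition _ p :=
  bilinear_isBilinear.Build R rV rV R _ _ (left_form p) (left_form_bilinear p).

Lemma left_form_sym p u v :
  left_form p u v = (-1) ^+ false * idfun (left_form p v u).
Proof.
by rewrite expr0 mul1r; apply: eq_bigr => i _; rewrite mulrC.
Qed.

HB.instance Definition _ p :=
  isHermitianSesquilinear.Build R rV false idfun (left_form p) (left_form_sym p).

Lemma left_form_gt0 p u : u != 0 -> 0 < left_form p u u.
Proof.
move=> u0; rewrite lt0r sumr_ge0 ?andbT => [|i _]; last first.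
  by rewrite -expr2 sqr_ge0.
apply: contra u0 => /eqP /psumr_eq0P H.
apply/eqP/(to_identity_inj (p := p))/rowP => i; rewrite mxE.
have /eqP := H (fun i _ => ltac:(rewrite -expr2; exact: sqr_ge0)) i isT.
by rewrite mulf_eq0 orbb => /eqP.
Qed.

HB.instance Definition _ p :=
  isDotProduct.Build R rV (left_form p) (@left_form_gt0 p).

End LeftMetric.

Section LeftMetricRecord.
Variables (R : realType) (n : nat) (G : lieGroupType R n).
Local Notation rV := 'rV[R]_n.
Implicit Types (p q : G).

Definition left_product p : scalar_product R n := left_form p : {dot _ for _}.

(** In a chart f, the left translate to 1 of the vector with coordinates u at x
    is the partial derivative along (0, u), at the point (x, x), of the smooth
    map (x, y) |-> (f^-1 x)^-1 * (f^-1 y). *)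
Lemma left_product_smooth (f : chart R n G) (u v : rV) : atlas f ->
  smooth_on (fun x => left_product (chart_inv f x)
    (coord_vector f x u) (coord_vector f x v) : R^o) (chart_cod f).
Proof.
move=> af k; set c := chart_at (1 : G)%g.
have ac : atlas c by exact: chart_at_atlas.
have of_ : open (chart_cod f) by exact: chart_cod_open.
have oA : open (chart_cod f `*` chart_cod f) by exact: open_setX.
pose H (z : rV * rV) := ((chart_inv f z.1)^-1 * chart_inv f z.2)%g.
have sH : Ck_into k.+1 H (chart_cod f `*` chart_cod f).
  apply: Ck_into_mul => //; last exact: Ck_into_snd.
  by apply: Ck_into_inv => //; exact: Ck_into_fst.
pose W w x : rV := 'D_(0, w) (c \o H) (x, x).
have sW w : Ck_on k (W w) (chart_cod f).
  apply: (Ck_on_comp _ of_ _ _ (smooth_partial w sH ac)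
    (f := fun x : rV => (x, x))).
  - by apply: has_coordinates_pair; exact: has_coordinates_rV.
  - move=> x fx; split=> //; rewrite /= /H /= mulVg; exact: chart_at_dom.
  - have cid : continuous (idfun : rV -> rV) by move=> x; exact: cvg_id.
    have sid := @Ck_on_linear R _ _ k idfun _ of_ cid.
    exact: (Ck_on_pair of_ sid sid).
have WE w x : chart_cod f x ->
    W w x = to_identity (chart_inv f x) (coord_vector f x w).
  move=> fx; rewrite to_identityE /W derive_snd.
  have dx := mdifferentiable_chart_inv af fx.
  rewrite -[coord_vector f x w]/(mD (chart_inv f) x w).
  rewrite -(mD_mdiff dx (mdiffable_lmul (chart_inv f x)^-1%g (chart_inv f x)) w).
  rewrite /mD /= mulVg.
  by [].
have sWi w i : Ck_on k (fun x => W w x 0 i : R^o) (chart_cod f).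
  apply: (Ck_on_comp (f := W w) (g := fun y : rV => y 0 i : R^o)
    (B := setT)) => //.
  - exact: has_coordinates_rV.
  - have coord_lin : linear (fun y : rV => y 0 i : R^o).
      by move=> a y z; rewrite !mxE.
    pose l : {linear rV -> R^o} := HB.pack (fun y : rV => y 0 i : R^o)
      (GRing.isLinear.Build _ _ _ _ _ coord_lin).
    apply: (@Ck_on_linear R _ _ k l setT openT); exact: coord_continuous.
have S : Ck_on k (fun x => \sum_i (W u x 0 i : R^o) *: (W v x 0 i : R^o))
    (chart_cod f).
  by apply: Ck_on_sum => // i; apply: Ck_on_scale.
by apply: eq_Ck_on S => // x fx; rewrite !WE.
Qed.

Definition left_metric : riemannian_metric G :=
  RiemannianMetric left_product_smooth.

Lemma left_metric_invariant : left_invariant left_metric.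
Proof.
move=> p q u v; rewrite /left_metric /= /left_product /= /left_form.
apply: eq_bigr => i _.
by rewrite (to_identity_translate p q u) (to_identity_translate p q v).
Qed.

Lemma left_metric1 u v : left_metric (1 : G)%g u v = \sum_i u 0 i * v 0 i.
Proof. by apply: eq_bigr => i _; rewrite !to_identity1. Qed.

End LeftMetricRecord.

(** * Homomorphisms into the line and linear growth *)

Section EuclideanNorm.
Variables (R : realType) (n : nat) (s : scalar_product R n).
Implicit Types u v : 'rV[R]_n.

Lemma sp_norm_sqr u : sp_norm s u ^+ 2 = s u u.
Proof. by rewrite sqr_sqrtr // scalar_product_ge0. Qed.

Lemma sp_norm_ge0 u : 0 <= sp_norm s u.
Proof. exact: sqrtr_ge0. Qed.

Lemma sp_normD u v : sp_norm s (u + v) <= sp_norm s u + sp_norm s v.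
Proof.
have H : sp_norm s (u + v) ^+ 2 <= (sp_norm s u + sp_norm s v) ^+ 2.
  rewrite sqrrD !sp_norm_sqr !(scalar_productDl, scalar_productDr).
  rewrite (scalar_productC s v u).
  have := cauchy_schwarz s u v; lra.
by rewrite ler_pXn2r ?nnegrE ?addr_ge0 ?sp_norm_ge0 // in H.
Qed.

Lemma sp_normN u : sp_norm s (- u) = sp_norm s u.
Proof. by rewrite /sp_norm hnormN. Qed.

Hypothesis sE : forall u v, s u v = \sum_i u 0 i * v 0 i.

Lemma norm_coord_le u i : `|u 0 i| <= sp_norm s u.
Proof.
rewrite -sqrtr_sqr; apply: ler_wsqrtr; rewrite sE (bigD1 i) //= -expr2 lerDl.
by apply: sumr_ge0 => j _; rewrite -expr2 sqr_ge0.
Qed.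

Lemma sp_norm_le_sum u : sp_norm s u <= \sum_i `|u 0 i|.
Proof.
have S0 : 0 <= \sum_i `|u 0 i| by exact: sumr_ge0.
rewrite -[leRHS](ger0_norm S0) -sqrtr_sqr; apply: ler_wsqrtr.
rewrite sE expr2 mulr_suml; apply: ler_sum => i _.
apply: le_trans (ler_norm _) _; rewrite normrM; apply: ler_wpM2l => //.
by rewrite (bigD1 i) //= lerDl sumr_ge0.
Qed.

End EuclideanNorm.

Section GrowthSufficient.
Variables (R : realType) (n : nat) (G : lieGroupType R n).
Implicit Types (p q : G).
Hypothesis G_connected : connected [set: G].
Let g := left_metric G.
Let r p := riemannian_dist g 1%g p.

Lemma dist_ge0 p : 0 <= r p.
Proof.
apply: le_riemannian_dist; first exact: connected_C1_path.
by move=> s _; exact: path_length_ge0.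
Qed.

(** The summand 1 in the constant C makes it nonzero, so that one can divide by
    it when passing to the infimum over all paths. *)
Lemma hom_growth (mu : G -> R) :
  (forall p q, mu (p * q)%g = mu p + mu q) ->
  differentiable ((mu : G -> R^o) \o chart_inv (chart_at (1 : G)%g))
    (chart_at (1 : G)%g 1%g) ->
  exists2 C : R, 0 <= C & forall p, `|mu p| <= C * r p.
Proof.
move=> muM; set mu1 := _ \o _; set e := chart_at _ _ => dmu.
pose C := 1 + \sum_i `|'d mu1 e (delta_mx 0 i) : R|.
have C0 : 0 < C by rewrite ltr_wpDr // sumr_ge0.
have dC w : `|'d mu1 e w : R| <= C * sp_norm (g 1%g) w.
  rewrite {1}(row_sum_delta w) linear_sum.
  apply: le_trans (ler_norm_sum _ _ _) _.
  rewrite /C mulrDl mul1r -[leLHS]add0r; apply: lerD; first exact: sp_norm_ge0.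
  rewrite mulr_suml; apply: ler_sum => i _; rewrite linearZ /= normrM mulrC.
  apply: ler_wpM2l => //; apply: norm_coord_le; exact: left_metric1.
exists C => [|p]; first exact: ltW.
rewrite -ler_pdivrMl //; apply: le_riemannian_dist.
  exact: connected_C1_path.
move=> s ps; rewrite ler_pdivrMl //.
have := hom_path_bound (@left_metric_invariant R n G) muM dmu dC ps.
have mu10 : mu 1%g = 0.
  by have := muM 1%g 1%g; rewrite mulg1 -[LHS]addr0 => /addrI.
by rewrite mu10 subr0.
Qed.

Hypothesis Ad1m_comp0 : forall p q u, Ad1m p (Ad1m q u) = 0.

Lemma Ad1m_growth : exists2 b : R, 0 <= b & forall p u,
  sp_norm (g 1%g) (Ad1m p u) <= b * r p * sp_norm (g 1%g) u.
Proof.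
pose mu (ij : 'I_n * 'I_n) p := Ad1m p (delta_mx 0 ij.1) 0 ij.2.
have H ij : exists C : R, 0 <= C /\ forall p, `|mu ij p| <= C * r p.
  have [||C C0 HC] := @hom_growth (mu ij).
  - by move=> p q; rewrite /mu Ad1mM Ad1m_comp0 addr0 mxE.
  - have d := Ad_differentiable G (delta_mx 0 ij.1).
    have d1 : differentiable (fun x => Ad (chart_inv (chart_at (1 : G)%g) x)
        (delta_mx 0 ij.1) + cst (- delta_mx 0 ij.1) x) (chart_at (1 : G)%g 1%g).
      by apply: differentiableD => //; exact: differentiable_cst.
    have dc := differentiable_comp d1 (differentiable_coord _ 0 ij.2).
    rewrite (_ : _ \o _ = (fun u : 'rV[R]_n => u 0 ij.2 : R^o) \o
      (fun x => Ad (chart_inv (chart_at (1 : G)%g) x)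
        (delta_mx 0 ij.1) + cst (- delta_mx 0 ij.1) x)); first exact: dc.
    by apply/funext => x; rewrite /= /mu Ad1mE.
  by exists C.
have [C HC] := choice H.
exists (\sum_j \sum_i C (i, j)) => [|p u].
  apply: sumr_ge0 => j _; apply: sumr_ge0 => i _.
  by have [] := HC (i, j).
apply: le_trans (sp_norm_le_sum (@left_metric1 R n G) _) _.
rewrite !mulr_suml; apply: ler_sum => j _.
rewrite {1}(row_sum_delta u) (linear_sum (Ad1m p)) summxE.
apply: le_trans (ler_norm_sum _ _ _) _.
rewrite !mulr_suml; apply: ler_sum => i _.
rewrite linearZ mxE normrM mulrC; apply: ler_pM => //.
  by have [_] := HC (i, j); apply.
exact: (norm_coord_le (@left_metric1 R n G)).
Qed.

(** For the lower bound, u = Ad p u - (Ad p - 1) (Ad p u), as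
    (Ad p - 1)^2 = 0. *)
Lemma linear_growth_of_comp_eq0 : linear_growth G.
Proof.
have [b b0 Hb] := Ad1m_growth.
exists g, (g 1%g), 1, b; split; first exact: left_metric_invariant.
move=> p; rewrite -/(r p) => k.
have k0 : 0 < k by rewrite /k ltr_wpDr // mulr_ge0 // dist_ge0.
split=> // u; apply/andP; split; last first.
  rewrite AdE; apply: le_trans (sp_normD _ _ _) _.
  by rewrite /k mulrDl mul1r lerD2l.
rewrite ler_pdivrMr // mulrC.
have -> : sp_norm (g 1%g) u = sp_norm (g 1%g) (Ad p u + - Ad1m p (Ad p u)).
  by congr sp_norm; rewrite !AdE Ad1mD Ad1m_comp0 addr0 addrK.
apply: le_trans (sp_normD _ _ _) _; rewrite sp_normN.
by rewrite /k mulrDl mul1r lerD2l.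
Qed.

End GrowthSufficient.

(** * Nilpotency class and iterated commutators *)

Section LowerCentral.
Variable G : groupType.

Lemma lower_central_subgroup k : is_subgroup (lower_central G k).
Proof.
case: k => [|k] //=; split; first by move=> A [[]].
move=> x y Hx Hy A HA; have [[_ sA] _] := HA.
by apply: sA; [exact: Hx|exact: Hy].
Qed.

Lemma lower_central_comm k x y : lower_central G k y ->
  lower_central G k.+1 (x * y * x^-1 * y^-1)%g.
Proof.
move=> ky /= A [_ HA]; apply: HA.
have [k1 kV] := lower_central_subgroup k.
exists x^-1%g => //; exists y^-1%g.
  by rewrite -[y^-1%g]mul1g; exact: kV.
by rewrite commgEl conjgE !invgK !mulgA.
Qed.

(** The commutator subgroup lies in the centre, which is a subgroup that
    contains all commutators. *)
Lemma lower_central2_trivial :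
  (forall x y z : G, [~ x, [~ y, z]] = 1)%g -> lower_central G 2 = [set 1%g].
Proof.
move=> H.
have center_sub : is_subgroup [set y : G | forall x, (x * y = y * x)%g].
  split=> [x|y z Hy Hz x] /=; first by rewrite mulg1 mul1g.
  by rewrite mulgA Hy -!mulgA; congr (_ * _)%g; exact: commuteV.
have one_sub : is_subgroup [set 1%g : G].
  by split=> // x y /= -> ->; rewrite mulgV.
have L1 y : lower_central G 1 y -> forall x, (x * y = y * x)%g.
  move=> /(_ [set y : G | forall x, (x * y = y * x)%g]); apply; split=> //.
  by move=> _ [x _ [z _ <-]] w /=; apply/commgP; rewrite H.
apply/seteqP; split=> [z|z ->]; last by have [] := lower_central_subgroup 2.
apply; split=> // _ [x _ [y Hy <-]] /=.
by apply/eqP/commgP; exact: L1.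
Qed.

End LowerCentral.

Theorem corollary5p7 (R : realType) (n m : nat) (G : lieGroupType R n)
    (m_ge1 : (1 <= m)%N) (G_connected : connected [set: G]%classic)
    (G_nilpotent : step_nilpotent m G) :
  linear_growth G <-> (m <= 2)%N.
Proof.
have [Gm Gk] := G_nilpotent; split=> [growth|m2].
  have sq0 := linear_growth_square_zero (m := m) G_connected _ growth.
  rewrite leqNgt; apply/negP => /Gk; apply.
  apply: lower_central2_trivial => x y z.
  have c2 : forall p q r : G, comm (comm p q) r = 1%g.
    apply: (comm_central G_connected); apply: sq0 => p x'.
    have : lower_central G m (iter m (comm p) x').
      by elim: (m) => [//|k IH]; exact: lower_central_comm.
    by rewrite Gm.
  have H : [~ y, z]%g = comm y^-1%g z^-1%g.
    by rewrite /comm !invgK commgEl conjgE !mulgA.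
  apply/eqP; rewrite commg1_sym; apply/commgP; rewrite H.
  have := c2 y^-1%g z^-1%g x; rewrite {1}/comm.
  move=> /(congr1 (fun a => a * x * comm y^-1 z^-1)%g).
  by rewrite !mulgVK mul1g.
apply: linear_growth_of_comp_eq0 => // p q u.
apply: Ad1m_comp_of_comm => r.
have r1 : lower_central G 1 (comm q r) by exact: lower_central_comm.
have r2 : lower_central G 2 (comm p (comm q r)) by exact: lower_central_comm.
move: m_ge1 m2 Gm r1 r2; case: (m) => [//|[|[|//]]] _ _ -> //.
by move=> -> _; rewrite comm1.
Qed.
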